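(* Let $\mathsf X=(I,X)$ be a general diffusion on a star-graph $\Gamma$ with central vertex $\mathbf v$, scales and speeds $(s_e,m_e)_{e\in E}$ and bias parameters $(\beta^{\mathbf v}_e)_{e\in E}$. Let $U=\bigcup_{e\in E}\{(e,x):x\in[0,u_e)\}$, with $0<u_e<l_e$ for all $e\in E$, $T_U=\inf\{t\ge0:\mathsf X_t\notin U\}$, and $v^j_0(\mathbf x)=\mathrm P_{\mathbf x}(I(T_U)=j)$. Then, for all $j\in E$ and $(e,x)\in U$, $$v^j_0(e,x)=\frac{s_e(u_e)-s_e(x)}{s_e(u_e)}\Big(\sum_{i\in E}\frac{\beta^{\mathbf v}_is_i'(0)}{s_i(u_i)}\Big)^{-1}\frac{\beta^{\mathbf v}_js_j'(0)}{s_j(u_j)}+\mathbf 1_{\{j=e\}}\frac{s_e(x)}{s_e(u_e)}.$$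
   Context: **Star-graph.** $\Gamma=\big(\bigsqcup_{e\in E}[0,l_e)\big)/\!\sim$ with $E=\{1,\dots,N\}$, $l_e\in(0,\infty]$, where $\sim$ identifies all points $(e,0)$ into the single central vertex $\mathbf v$. It carries the geodesic distance. **General diffusion on the star-graph.** A regular continuous strong Markov process $\mathsf X=(I,X)$ on $\Gamma$ without killing ($I$ edge label, $X$ coordinate), $\mathsf X_0=\mathbf x$ under $\mathrm P_{\mathbf x}$, determined by positive locally finite measures $m_e$ on $[0,l_e)$ (speeds), continuous increasing functions $s_e$ (scales), $\rho_{\mathbf v}\ge0$, and $\beta^{\mathbf v}_e>0$ with $\sum_e\beta^{\mathbf v}_e=1$: its generator is $\mathrm Lf(e,x)=\frac12\mathrm D_{m_e}\mathrm D_{s_e}f(e,x)$ on the set of $f\in C(\Gamma)$ with $\mathrm Lf\in C(\Gamma)$ and $\sum_{e'\in E}\beta^{\mathbf v}_{e'}f'(e',0)=\rho_{\mathbf v}\,\mathrm Lf(\mathbf v)$. Conventions: $s_e(0)=0$ for all $e\in E$; each $s_e$ is a difference of convex functions, so that the right-derivative $s_e'(0)$ is defined. It is implicit in the formula that the inverted sum is non-zero. *)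

(* Defs.v *)
From HB Require Import structures.
From mathcomp Require Import all_boot all_order all_algebra.
From mathcomp Require Import generic_quotient.
From mathcomp Require Import all_classical all_reals all_analysis.
From mathcomp Require Import measurable_realfun.
Set Implicit Arguments.
Unset Strict Implicit.
Unset Printing Implicit Defensive.
Import Order.TTheory GRing.Theory Num.Theory.
Import numFieldNormedType.Exports.
Local Open Scope classical_set_scope.
Local Open Scope ring_scope.

(* The [nedge.+1] edges are indexed by [edge]; an edge may be infinite. *)
Record star_graph (R : realType) := StarGraph {
  nedge : nat;
  len : 'I_nedge.+1 -> \bar R;
  len_gt0 : forall e, (0 < len e)%E }.

Definition edge (R : realType) (G : star_graph R) := 'I_(nedge G).+1.

Definition on_edge (R : realType) (G : star_graph R) (e : edge G) : set R :=
  [set x : R | 0 <= x /\ (x%:E < len e)%E].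

(* The disjoint union of the half-open edges [0, l_e). *)
Definition edges (R : realType) (G : star_graph R) :=
  {p : edge G * R | (0 <= p.2) && (p.2%:E < len p.1)%E}.

Lemma edges_vertex_subproof (R : realType) (G : star_graph R) :
  let p : edge G * R := (ord0, 0) in (0 <= p.2) && (p.2%:E < len p.1)%E.
Proof. by rewrite /= lexx len_gt0. Qed.

Definition edges_vertex (R : realType) (G : star_graph R) : edges G :=
  exist _ (ord0, 0) (edges_vertex_subproof G).

Definition glue (R : realType) (G : star_graph R) : rel (edges G) :=
  fun a b => (a == b) || (((val a).2 == 0) && ((val b).2 == 0)).

Lemma glue_refl (R : realType) (G : star_graph R) : reflexive (@glue R G).
Proof. by move=> a; rewrite /glue eqxx. Qed.

Lemma glue_sym (R : realType) (G : star_graph R) : symmetric (@glue R G).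
Proof. by move=> a b; rewrite /glue eq_sym andbC. Qed.

Lemma glue_trans (R : realType) (G : star_graph R) : transitive (@glue R G).
Proof.
move=> b a c; rewrite /glue => /predU1P[-> //|/andP[a0 b0]] /predU1P[<-|].
  by rewrite a0 b0 orbT.
by case/andP=> _ c0; rewrite a0 c0 orbT.
Qed.

Canonical glue_equiv (R : realType) (G : star_graph R) :=
  EquivRel (@glue R G) (@glue_refl R G) (@glue_sym R G) (@glue_trans R G).

Definition star (R : realType) (G : star_graph R) := {eq_quot (@glue R G)}%qT.

HB.instance Definition _ (R : realType) (G : star_graph R) :=
  Choice.on (star G).

Section star_points.
Context (R : realType) (G : star_graph R).

(* At the central vertex, [label] is an arbitrary edge. *)
Definition label (p : star G) : edge G := (val (repr p)).1.
Definition coord (p : star G) : R := (val (repr p)).2.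

Definition vertex : star G := (\pi_(star G) (edges_vertex G))%qT.

(* The point (e, x); it is the central vertex when x is outside [0, l_e). *)
Definition pt (e : edge G) (x : R) : star G :=
  (\pi_(star G) (insubd (edges_vertex G) (e, x)))%qT.

Lemma glue_repr (a : edges G) : glue (repr (\pi_(star G) a)%qT) a.
Proof.
by have /eqP := reprK (\pi_(star G) a)%qT; rewrite (eqmodE (@glue_equiv R G)).
Qed.

Lemma coord_ge0 p : 0 <= coord p.
Proof. by rewrite /coord; case: (repr p) => -[e x] /= /andP[]. Qed.

Lemma coord_label p : ((coord p)%:E < len (label p))%E.
Proof. by rewrite /coord /label; case: (repr p) => -[e x] /= /andP[]. Qed.

Lemma val_pt e x : on_edge e x ->
  val (insubd (edges_vertex G) (e, x)) = (e, x).
Proof. by move=> [x0 xl]; rewrite val_insubd /= x0 xl. Qed.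

Lemma coord_pt e x : on_edge e x -> coord (pt e x) = x.
Proof.
move=> ex; rewrite /coord; have := glue_repr (insubd (edges_vertex G) (e, x)).
rewrite -/(pt e x) => /predU1P[->|/andP[/eqP->]]; rewrite val_pt//.
by move=> /eqP.
Qed.

Lemma label_pt e x : on_edge e x -> x != 0 -> label (pt e x) = e.
Proof.
move=> ex x0; rewrite /label; have := glue_repr (insubd (edges_vertex G) (e, x)).
rewrite -/(pt e x) => /predU1P[->|/andP[_]]; rewrite val_pt//.
by rewrite (negbTE x0).
Qed.

Lemma pt0 e : pt e 0 = vertex.
Proof.
apply/eqP; rewrite (eqmodE (@glue_equiv R G)) /= /glue.
by rewrite val_pt ?eqxx ?orbT//; split; rewrite ?len_gt0.
Qed.

Lemma coord_eq0 p : coord p = 0 -> p = vertex.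
Proof.
move=> p0; rewrite -[p]reprK; apply/eqP.
rewrite (eqmodE (@glue_equiv R G)) /= /glue.
by rewrite -/(coord p) p0 eqxx orbT.
Qed.

Lemma ptK p : pt (label p) (coord p) = p.
Proof.
rewrite /pt; have -> : (label p, coord p) = val (repr p).
  by rewrite /label /coord; case: (val _).
by rewrite valKd reprK.
Qed.

Definition geodist (p q : star G) : R :=
  if label p == label q then `|coord p - coord q| else coord p + coord q.

Lemma geodistxx p : geodist p p = 0.
Proof. by rewrite /geodist eqxx subrr normr0. Qed.

Lemma geodist_positivity p q : geodist p q = 0 -> p = q.
Proof.
rewrite /geodist; case: eqVneq => [pq /normr0_eq0/subr0_eq xy|pq /eqP].
  by rewrite -[p]ptK -[q]ptK pq xy.
rewrite paddr_eq0 ?coord_ge0// => /andP[/eqP p0 /eqP q0].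
by rewrite (coord_eq0 p0) (coord_eq0 q0).
Qed.

Lemma geodist_sym p q : geodist p q = geodist q p.
Proof. by rewrite /geodist eq_sym distrC (addrC (coord p)). Qed.

Lemma geodist_triangle q p r : geodist p r <= geodist p q + geodist q r.
Proof.
rewrite /geodist.
have p0 := coord_ge0 p; have q0 := coord_ge0 q; have r0 := coord_ge0 r.
have [pr|pr] := eqVneq (label p) (label r);
  have [pq|pq] := eqVneq (label p) (label q);
  have [qr|qr] := eqVneq (label q) (label r).
- rewrite (_ : coord p - coord r =
      (coord p - coord q) + (coord q - coord r)) ?ler_normD//.
  by rewrite addrA subrK.
- by rewrite -pq pr eqxx in qr.
- by rewrite pr qr eqxx in pq.
- rewrite (le_trans (ler_normB _ _))// !ger0_norm//.
  by apply: lerD; [rewrite lerDl|rewrite lerDr].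
- by rewrite pq qr eqxx in pr.
- by rewrite addrA lerD2r addrC -lerBlDl ler_norm.
- by rewrite -addrA lerD2l distrC addrC -lerBlDr ler_norm.
- by apply: lerD; [rewrite lerDl|rewrite lerDr].
Qed.

HB.instance Definition _ := @isMetric.Build R (star G) geodist
  geodistxx geodist_positivity geodist_sym geodist_triangle.
HB.instance Definition _ := isPointed.Build (star G) vertex.

End star_points.

Definition borel_star (R : realType) (G : star_graph R) :=
  g_sigma_algebraType (@open (star G)).

Definition rquotient (R : realType) (f : R -> R) (x h : R) : R :=
  (f (x + h) - f x) / h.

Definition rderivable (R : realType) (f : R -> R) (x : R) :=
  cvg (rquotient f x h @[h --> 0^'+]).

Definition rderiv (R : realType) (f : R -> R) (x : R) : R :=
  lim (rquotient f x h @[h --> 0^'+]).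

Definition convex_on (R : realType) (D : set R) (f : R -> R) :=
  @convex_function R R^o D f.

(* The speed [speed e] is a measure on the line of which only the trace on
   [0, l_e) matters. *)
Record diffusion_data (R : realType) (G : star_graph R) := DiffusionData {
  scale : edge G -> R -> R;
  speed : edge G -> {measure set (measurableTypeR R) -> \bar R};
  stickiness : R;
  bias : edge G -> R;
  scale0 : forall e, scale e 0 = 0;
  scale_continuous : forall e, {within on_edge e, continuous (scale e)};
  scale_increasing : forall e x y, on_edge e x -> on_edge e y ->
    x < y -> scale e x < scale e y;
  scale_dc : forall e, exists c1 c2 : R -> R,
    [/\ convex_on (on_edge e) c1, convex_on (on_edge e) c2 &
        forall x, on_edge e x -> scale e x = c1 x - c2 x];
  scale_rderivable0 : forall e, rderivable (scale e) 0;
  speed_locally_finite : forall e x, on_edge e x ->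
    (speed e `[0%R, x]%classic < +oo)%E;
  speed_positive : forall e x y, on_edge e x -> on_edge e y -> x < y ->
    (0 < speed e `]x, y[%classic)%E;
  stickiness_ge0 : 0 <= stickiness;
  bias_gt0 : forall e, 0 < bias e;
  bias_sum1 : \sum_(e : edge G) bias e = 1 }.

(* F = D_s f on D, as a right derivative with respect to s. *)
Definition is_Dscale (R : realType) (D : set R) (s f F : R -> R) :=
  forall x, D x ->
    (f y - f x) / (s y - s x) @[y --> x^'+] --> F x.

(* h = D_m F on D, as a derivative with respect to the measure m. *)
Definition is_Dspeed (R : realType) (D : set R)
    (m : {measure set (measurableTypeR R) -> \bar R}) (F h : R -> R) :=
  forall x y, D x -> D y -> x <= y ->
    F y - F x = \int[m]_(z in `]x, y]%classic) h z.

Definition Cb (R : realType) (G : star_graph R) (f : star G -> R) :=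
  continuous f /\ exists M : R, forall p, `|f p| <= M.

Definition vertex_condition (R : realType) (G : star_graph R)
    (D : diffusion_data G) (f g : star G -> R) :=
  (forall e, rderivable (fun x => f (pt e x)) 0) /\
  \sum_(e : edge G) bias D e * rderiv (fun x => f (pt e x)) 0 =
    stickiness D * g (vertex G).

(* The graph of L: f is in the domain and L f = g. *)
Definition diffusion_op (R : realType) (G : star_graph R)
    (D : diffusion_data G) (f g : star G -> R) :=
  [/\ Cb f, Cb g,
      forall e, exists F h : R -> R,
        [/\ is_Dscale (on_edge e) (scale D e) (fun x => f (pt e x)) F,
            is_Dspeed (on_edge e) (speed D e) F h &
            forall x, on_edge e x -> g (pt e x) = h x / 2] &
      vertex_condition D f g].

Section diffusion.
Context (R : realType) (G : star_graph R).
Context (d : measure_display) (Omega : measurableType d).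
Implicit Types (F : R -> set (set Omega)) (tau : Omega -> \bar R).
Implicit Types (P : star G -> probability Omega R) (X : R -> Omega -> star G).

Definition filtration F :=
  [/\ forall t : R, 0 <= t -> sigma_algebra setT (F t),
      forall t : R, 0 <= t -> F t `<=` measurable &
      forall s t : R, 0 <= s -> s <= t -> F s `<=` F t].

Definition adapted F X :=
  forall (t : R) (B : set (borel_star G)), 0 <= t -> measurable B ->
    F t (X t @^-1` B).

Definition stopping_time F tau :=
  (forall w, (0 <= tau w)%E) /\
  forall t : R, 0 <= t -> F t [set w | (tau w <= t%:E)%E].

Definition stopped_events F tau : set (set Omega) :=
  [set A | measurable A /\
    forall t : R, 0 <= t -> F t (A `&` [set w | (tau w <= t%:E)%E])].

Definition markov_kernel P X :=
  forall (t : R) (B : set (borel_star G)), 0 <= t -> measurable B ->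
    measurable_fun [set: borel_star G]
      (fun p : borel_star G => P p (X t @^-1` B)).

Definition strong_markov F P X :=
  forall (p : star G) tau (A : set Omega) (t : R) (B : set (borel_star G)),
    stopping_time F tau -> stopped_events F tau A -> 0 <= t -> measurable B ->
    P p (A `&` [set w | (tau w < +oo)%E /\ B (X (fine (tau w) + t) w)]) =
    (\int[P p]_(w in A `&` [set w | tau w < +oo])
        P (X (fine (tau w)) w) (X t @^-1` B))%E.

Definition regular P X :=
  forall p q : star G,
    (0 < P p [set w | exists2 t : R, (0 <= t)%R & X t w = q])%E.

Definition semigroup P X (t : R) (f : star G -> R) (p : star G) : R :=
  \int[P p]_w f (X t w).

(* The generator on C_b in the sense of bounded pointwise convergence; on a
   non-compact star the semigroup need not be strongly continuous on C_b. *)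
Definition generator P X (f g : star G -> R) :=
  [/\ Cb f, Cb g,
      forall p, (semigroup P X t f p - f p) / t @[t --> 0^'+] --> g p &
      exists M : R, \forall t \near 0^'+,
        forall p, `|(semigroup P X t f p - f p) / t| <= M].

Record general_diffusion (D : diffusion_data G) F P X : Prop := {
  gd_filtration : filtration F;
  gd_adapted : adapted F X;
  gd_initial : forall p, P p [set w | X 0 w = p] = 1%E;
  gd_continuous : forall w, {within `[0, +oo[%classic, continuous (X ^~ w)};
  gd_kernel : markov_kernel P X;
  gd_strong_markov : strong_markov F P X;
  gd_regular : regular P X;
  gd_generator : forall f g, generator P X f g <-> diffusion_op D f g }.

Definition exit_time X (U : set (star G)) (w : Omega) : \bar R :=
  ereal_inf [set t%:E | t in [set t : R | 0 <= t /\ ~ U (X t w)]].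

(* v_0^j(p) = P_p (I (T_U) = j), the event being understood on T_U < oo. *)
Definition exit_prob P X (U : set (star G)) (j : edge G) (p : star G) :
    \bar R :=
  P p [set w | (exit_time X U w < +oo)%E /\
               label (X (fine (exit_time X U w)) w) = j].

End diffusion.

Definition star_nbhd (R : realType) (G : star_graph R) (u : edge G -> R) :
    set (star G) :=
  \bigcup_e (pt e @` `[0, u e[%classic).

(* Main.v *)
From mathcomp Require Import ring lra.
From Pilot Require Import Defs.
From HB Require Import structures.
From mathcomp Require Import all_boot all_order all_algebra.
From mathcomp Require Import all_classical all_reals all_analysis.
From mathcomp Require Import measurable_realfun giry.
(* MathComp has its own [coord] and [scale_continuous]. *)
Import Pilot.Defs.
Set Implicit Arguments.
Unset Strict Implicit.
Unset Printing Implicit Defensive.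
Import Order.TTheory GRing.Theory Num.Theory.
Import numFieldNormedType.Exports.
Local Open Scope classical_set_scope.
Local Open Scope ring_scope.

(* The exit law is identified by testing the process against explicit functions
   of the domain of the generator, using the Markov property at deterministic
   times only. On the edge e the function
     f(x) = a + b s(x) + \int_(]0, x]) (s(x) - s(z)) h(z) m(dz)
   satisfies D_m D_s f = h; taking h constant on [0, u_e] and bending it between
   u_e and l_e so that the slope D_s f vanishes eventually keeps f bounded.
   For A in F_a, the map t |-> E[f(X_t); A] is Lipschitz with right derivative
   E[Lf(X_t); A] on [a, +oo[, so Lf >= c on U bounds from below the increments
   of the process stopped at the first multiple of delta after exit, up to
   an error of order delta. With Lf = 1 on U this shows that the exit time is
   finite almost surely. With Lf = 0 on U, applied to f and - f and delta -> 0,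
   it gives E[f(X_T)] = f(x), and f is chosen harmonic with boundary values
   f(i, u_i) = 1_(i = j). *)

(** The obstacle behind the bending is that the generator acts on bounded continuous functions,
    while a scale may be unbounded towards the end of its edge. Working step by step on a grid
    stands in for Dynkin's formula at the exit time: there is no integral in time, hence no question
    of joint measurability. A path still inside U at k delta may leave during the next step, where
    only |Lf| <= C is known. That step then costs C delta times the probability of leaving during
    it; these events are disjoint for different k, so the total cost is at most C delta for any
    number of steps. The vertex condition fixes the slopes. If D_s f equals b_i at the vertex along
    edge i, it reads: the sum of beta_i b_i s_i'(0) is rho Lf(v). A function equal to a at the
    vertex, harmonic in U and equal to 1_(i = j) at u_i has b_i = (1_(i = j) - a) / s_i(u_i); the
    condition then determines a, which is the exit probability from the vertex. For Lf = 1 a common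
    slope on all edges suffices, because the sum of beta_i s_i'(0) is non-zero. *)

Lemma bounded_integrable d (T : measurableType d) (R : realType)
    (mu : {measure set T -> \bar R}) (A : set T) (f : T -> R) (M : R) :
  measurable A -> (mu A < +oo)%E -> measurable_fun A f ->
  (forall x, A x -> `|f x| <= M) -> mu.-integrable A (EFin \o f).
Proof.
move=> mA muA mf fM; apply: measurable_bounded_integrable => //.
exists M; split; first exact: num_real.
by move=> y My x Ax /=; rewrite (le_trans (fM _ Ax))// ltW.
Qed.

Lemma norm_Rintegral_le d (T : measurableType d) (R : realType)
    (mu : {measure set T -> \bar R}) (A : set T) (f : T -> R) (M : R) :
  measurable A -> (mu A < +oo)%E -> measurable_fun A f ->
  (forall x, A x -> `|f x| <= M) ->
  `|\int[mu]_(x in A) f x| <= M * fine (mu A).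
Proof.
move=> mA muA mf fM; have fi := bounded_integrable mA muA mf fM.
rewrite (le_trans (le_normr_Rintegral mA fi))// -Rintegral_cst//.
apply: le_Rintegral => //; first exact: (integrable_norm fi).
by apply: (@bounded_integrable _ _ _ _ _ _ `|M| mA muA (measurable_cst M)).
Qed.

(** * Solutions on one edge *)

Section edge_solution.
Context (R : realType) (G : star_graph R) (D : diffusion_data G) (e : edge G).
Local Notation s := (scale D e).
Local Notation m := (speed D e).
Local Notation E := (@on_edge R G e).

Lemma on_edge_le x y : 0 <= x -> x <= y -> E y -> E x.
Proof. by move=> x0 xy [_ yl]; split=> //; apply: le_lt_trans yl;
  rewrite lee_fin. Qed.

Lemma on_edge_gt x : E x -> exists2 y, E y & x < y.
Proof.
rewrite /on_edge/= => -[x0]; case: (len e) (len_gt0 e) => [r| |]//.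
  rewrite !lte_fin => r0 xr; exists ((x + r) / 2); last by lra.
  by split; [lra|rewrite lte_fin; lra].
by move=> _ _; exists (x + 1); [split; [lra|rewrite ltey] | lra].
Qed.

Lemma on_edge0 : E 0.
Proof. by split=> //; exact: len_gt0. Qed.

Lemma scale_le x y : E x -> E y -> x <= y -> s x <= s y.
Proof.
by move=> Ex Ey; rewrite le_eqVlt => /predU1P[->//|xy];
  exact/ltW/scale_increasing.
Qed.

Lemma scale_gt0 x : E x -> 0 < x -> 0 < s x.
Proof.
by move=> Ex x0; rewrite -(scale0 D e); apply: scale_increasing => //;
  exact: on_edge0.
Qed.

Lemma speed_itv_lty x y : 0 <= x -> E y -> (m `]x, y]%classic < +oo)%E.
Proof.
move=> x0 Ey; apply: le_lt_trans (speed_locally_finite D Ey).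
apply: le_measure; rewrite ?inE//; try exact: measurable_itv.
by apply: subset_itvr; rewrite bnd_simp.
Qed.

Lemma measurable_on_edge : measurable E.
Proof.
rewrite /on_edge; move: (len_gt0 e); case: (len e) => [r| |]// _.
  rewrite (_ : mkset _ = `[0, r[%classic); first exact: measurable_itv.
  by apply/seteqP; split=> x/=; rewrite in_itv/= lte_fin => /andP.
rewrite (_ : mkset _ = `[0, +oo[%classic); first exact: measurable_itv.
by apply/seteqP; split=> x/=; rewrite in_itv/= ?andbT ?ltey// => -[].
Qed.

Lemma measurable_scale : measurable_fun E s.
Proof.
apply: subspace_continuous_measurable_fun; first exact: measurable_on_edge.
exact: scale_continuous.
Qed.

Lemma measurable_scale_itv x y : 0 <= x -> E y -> measurable_fun `]x,
  y]%classic s.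
Proof.
move=> x0 Ey; apply: measurable_funS measurable_scale;
  first exact: measurable_on_edge.
by move=> z/=; rewrite in_itv/= => /andP[xz zy];
  apply: (on_edge_le _ zy) => //; lra.
Qed.

(** Continuity from above along half-open intervals shrinking to the right of [x]. This smallness
    turns the remainder of [edge_fun] at [x] into an o(s y - s x). *)
Lemma speed_right_small x (r : R) : E x -> 0 < r ->
  exists2 y, E y /\ x < y & forall z, x <= z <= y -> fine (m `]x, z]%classic)
    <= r.
Proof.
move=> Ex r0; have [y Ey xy] := on_edge_gt Ex.
have x0 : 0 <= x by case: Ex.
pose I (n : nat) : set R := `]x, x + (y - x) / n.+1%:R]%classic.
have yn n : x < x + (y - x) / n.+1%:R <= y.
  rewrite ltrDl divr_gt0 ?subr_gt0//= -lerBrDl ler_pdivrMr// ler_peMr ?ler1n//.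
  by rewrite subr_ge0 ltW.
have EI n : E (x + (y - x) / n.+1%:R).
  by have /andP[xn ny] := yn n; apply: on_edge_le ny _ => //;
    rewrite (le_trans x0)// ltW.
have : m (I n) @[n --> \oo] --> m (\bigcap_n I n).
  apply: nonincreasing_cvg_mu.
  - exact: speed_itv_lty.
  - by move=> n; exact: measurable_itv.
  - by apply: bigcap_measurable => // n _; exact: measurable_itv.
  - move=> i j ij; apply/subsetPset; apply: subset_itvl;
    rewrite bnd_simp lerD2l.
    by rewrite ler_pM2l ?subr_gt0// lef_pV2 ?posrE// ler_nat.
(* The left endpoint is excluded, so a possible atom of the speed at [x] does not count. *)
have -> : \bigcap_n I n = set0.
  apply/seteqP; split=> // z Iz; have := Iz 0%N Logic.I;
    rewrite /I/= in_itv/= => /andP[xz _].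
  have [n] : exists n : nat, (y - x) / (z - x) < n%:R.
    by exists (Num.bound ((y - x) / (z - x)));
      rewrite archi_boundP// divr_ge0// subr_ge0 ltW.
  rewrite ltr_pdivrMr ?subr_gt0// => yn'; have := Iz n Logic.I;
    rewrite /I/= in_itv/= => /andP[_].
  rewrite -lerBlDl ler_pdivlMr// => /le_lt_trans/(_ yn').
  rewrite mulrC ltr_pM2r ?subr_gt0// => /ltW.
  by rewrite ler_nat ltnn.
rewrite measure0 => /fine_cvgP[_ /cvgr0Pnorm_lt/(_ r r0)[N _ /(_ N (leqnn
  N))/=]].
rewrite ger0_norm ?fine_ge0// => mN.
exists (x + (y - x) / N.+1%:R); first by split=> //; case/andP: (yn N).
move=> z /andP[xz zN]; apply: le_trans (ltW mN).
have Ez : E z by apply: on_edge_le zN (EI N); exact: le_trans xz.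
apply: fine_le.
- by rewrite ge0_fin_numE// speed_itv_lty.
- by rewrite ge0_fin_numE// speed_itv_lty.
- apply: le_measure; rewrite ?inE//; try exact: measurable_itv.
  by apply: subset_itvl; rewrite bnd_simp.
Qed.

Context (h : R -> R) (M : R).
Hypothesis ch : continuous h.
Hypothesis hM : forall x, `|h x| <= M.

Lemma integrable_speed x y : 0 <= x -> E y -> m.-integrable `]x, y]%classic
  (EFin \o h).
Proof.
move=> x0 Ey; apply: (@bounded_integrable _ _ _ _ _ _ M) => //.
- exact: speed_itv_lty.
- by apply: measurable_funS (continuous_measurable_fun ch).
Qed.

Definition edge_slope b x := b + \int[m]_(z in `]0, x]%classic) h z.
(** This is a + int_0^x F ds with F = [edge_slope b], the double integral being exchanged by Fubini:
    a single integral against the speed remains, and none against ds. *)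
Definition edge_fun a b x :=
  a + b * s x + \int[m]_(z in `]0, x]%classic) ((s x - s z) * h z).

Lemma Rintegral_speed_cat (g : R -> R) x y : 0 <= x -> x <= y ->
    m.-integrable `]0, y]%classic (EFin \o g) ->
  \int[m]_(z in `]0, y]%classic) g z =
  \int[m]_(z in `]0, x]%classic) g z + \int[m]_(z in `]x, y]%classic) g z.
Proof.
move=> x0 xy gi; rewrite (@itv_bndbnd_setU _ _ _ (BRight x)) ?bnd_simp//.
rewrite Rintegral_setU//; try exact: measurable_itv.
- by rewrite -itv_bndbnd_setU// bnd_simp.
- apply/disj_setPS => z [/=]; rewrite !in_itv/= => /andP[_ zx] /andP[xz _].
  by move: (lt_le_trans xz zx); rewrite ltxx.
Qed.

Lemma integrable_scale_speed x y c : 0 <= x -> E y -> E c ->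
  m.-integrable `]x, y]%classic (EFin \o (fun z => (s c - s z) * h z)).
Proof.
move=> x0 Ey Ec.
apply: (@bounded_integrable _ _ _ _ _ _ ((s c + s y) * M)) => //.
- exact: speed_itv_lty.
- apply: measurable_funM; last by apply: measurable_funS
  (continuous_measurable_fun ch).
  by apply: measurable_funB => //; exact: measurable_scale_itv.
- move=> z /=; rewrite in_itv/= => /andP[xz zy].
  have Ez : E z by apply: on_edge_le zy Ey; lra.
  have sz : 0 <= s z by rewrite -(scale0 D e) scale_le//; [exact: on_edge0|lra].
  have sc : 0 <= s c by rewrite -(scale0 D e) scale_le//;
    [exact: on_edge0|case: Ec].
  have szy := scale_le Ez Ey zy.
  by rewrite normrM ler_pM// (le_trans (ler_normB _ _))// !ger0_norm// lerD2l.
Qed.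

(** First-order Taylor expansion at [x] in the variable s, with integral remainder. It yields the
    derivative, the Lipschitz bound and the constancy of the solution where slope and right-hand
    side vanish. *)
Lemma edge_funB a b x y : E x -> E y -> x <= y ->
  edge_fun a b y - edge_fun a b x = (s y - s x) * edge_slope b x +
    \int[m]_(z in `]x, y]%classic) ((s y - s z) * h z).
Proof.
move=> Ex Ey xy; have x0 : 0 <= x by case: Ex.
rewrite /edge_fun (@Rintegral_speed_cat _ x y)//;
  last exact: integrable_scale_speed.
have -> : \int[m]_(z in `]0, x]%classic) ((s y - s z) * h z) =
    (s y - s x) * \int[m]_(z in `]0, x]%classic) h z +
    \int[m]_(z in `]0, x]%classic) ((s x - s z) * h z).
  rewrite -RintegralZl//; last exact: integrable_speed.
  rewrite -RintegralD//; last 2 first.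
    by have := @integrableZl _ _ _ m _ (measurable_itv _) (s y - s x) (EFin \o
      h) (integrable_speed (lexx 0) Ex); apply.
    exact: integrable_scale_speed.
  by apply: eq_Rintegral => z _; rewrite -mulrDl; congr (_ * _); ring.
rewrite /edge_slope; ring.
Qed.

Lemma edge_funB_bound a b x y : E x -> E y -> x <= y ->
  `|edge_fun a b y - edge_fun a b x - (s y - s x) * edge_slope b x| <=
    (s y - s x) * M * fine (m `]x, y]%classic).
Proof.
move=> Ex Ey xy; have x0 : 0 <= x by case: Ex.
rewrite edge_funB// addrAC subrr add0r; apply: norm_Rintegral_le => //.
- exact: speed_itv_lty.
- apply: measurable_funM; last by apply: measurable_funS
  (continuous_measurable_fun ch).
  by apply: measurable_funB => //; exact: measurable_scale_itv.
- move=> z /=; rewrite in_itv/= => /andP[xz zy].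
  have Ez : E z by apply: on_edge_le zy Ey; lra.
  have szy := scale_le Ez Ey zy; have sxz := scale_le Ex Ez (ltW xz).
  by rewrite normrM ler_pM// ger0_norm; lra.
Qed.

Lemma is_Dscale_edge_fun a b : is_Dscale E s (edge_fun a b) (edge_slope b).
Proof.
move=> x Ex; apply/cvgrPdist_le => r r0.
have M0 : 0 <= M by apply: le_trans (hM 0).
(* [M + 1] because [M] may be 0. *)
have rM : 0 < r / (M + 1) by apply: divr_gt0 => //; lra.
have [y [Ey xy] my] := speed_right_small Ex rM.
near=> z.
have xz : x < z by near: z; exact: nbhs_right_gt.
have zy : z <= y by near: z; exact: nbhs_right_le.
have x0 : 0 <= x by case: Ex.
have Ez : E z by apply: on_edge_le zy Ey; lra.
have sxz := @scale_increasing _ _ D e _ _ Ex Ez xz.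
rewrite distrC -(ler_pM2l (_ : 0 < s z - s x)) ?subr_gt0//.
rewrite -{1}(@gtr0_norm _ (s z - s x)) ?subr_gt0// -normrM mulrBr mulrCA divff
  ?subr_eq0 ?gt_eqF//.
rewrite mulr1 (le_trans (edge_funB_bound _ _ Ex Ez (ltW xz)))// -mulrA ler_pM2l
  ?subr_gt0//.
have := my z; rewrite (ltW xz) zy => /(_ isT) mz.
rewrite (le_trans (ler_wpM2l M0 mz))// mulrCA ler_piMr ?(ltW r0)//.
by rewrite ler_pdivrMr; lra.
Unshelve. all: by end_near. Qed.

Lemma is_Dspeed_edge_slope b : is_Dspeed E m (edge_slope b) h.
Proof.
move=> x y Ex Ey xy; rewrite /edge_slope opprD addrACA subrr add0r.
have x0 : 0 <= x by case: Ex.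
rewrite (@Rintegral_speed_cat _ x y)//; first by rewrite addrAC subrr add0r.
exact: integrable_speed.
Qed.

Lemma edge_slope_bound b x c : 0 <= x -> x <= c -> E c ->
  `|edge_slope b x| <= `|b| + M * fine (m `]0, c]%classic).
Proof.
move=> x0 xc Ec; rewrite (le_trans (ler_normD _ _))// lerD2l.
have Ex := on_edge_le x0 xc Ec.
have M0 : 0 <= M by apply: le_trans (hM 0).
apply: (@le_trans _ _ (M * fine (m `]0, x]%classic))).
  apply: norm_Rintegral_le => //; first exact: speed_itv_lty.
  by apply: measurable_funS (continuous_measurable_fun ch).
rewrite ler_wpM2l// fine_le//.
- by rewrite ge0_fin_numE ?speed_itv_lty.
- by rewrite ge0_fin_numE ?speed_itv_lty.
- apply: le_measure; rewrite ?inE//; try exact: measurable_itv.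
  by apply: subset_itvl; rewrite bnd_simp.
Qed.

(** Lipschitz with respect to s, not to the coordinate: continuity and boundedness on compact parts
    of the edge are inherited from the scale. *)
Lemma edge_fun_lipschitz a b c : E c -> exists2 K, 0 < K &
  forall x y, 0 <= x -> x <= y -> y <= c ->
  `|edge_fun a b y - edge_fun a b x| <= K * (s y - s x).
Proof.
move=> Ec; have M0 : 0 <= M by apply: le_trans (hM 0).
have m0 : 0 <= M * fine (m `]0, c]%classic) by rewrite mulr_ge0// fine_ge0.
(* A bound for the slope on [0, c], then one for the remainder; the final 1 makes the constant
   positive. *)
exists (`|b| + M * fine (m `]0, c]%classic) + M * fine (m `]0, c]%classic) + 1).
  by have := normr_ge0 b; lra.
move=> x y x0 xy yc.
have Ey : E y by apply: on_edge_le yc Ec; lra.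
have Ex : E x by apply: on_edge_le xy Ey.
have sxy := scale_le Ex Ey xy.
rewrite -[X in `|X|](subrK ((s y - s x) * edge_slope b x)).
rewrite (le_trans (ler_normD _ _))// (le_trans (lerD (edge_funB_bound _ _ Ex Ey
  xy) (lexx _)))//.
rewrite normrM ger0_norm ?subr_ge0// -mulrA -mulrDr mulrC ler_wpM2r ?subr_ge0//.
have := edge_slope_bound b x0 (le_trans xy yc) Ec.
suff : M * fine (m `]x, y]%classic) <= M * fine (m `]0, c]%classic) by lra.
rewrite ler_wpM2l// fine_le//.
- by rewrite ge0_fin_numE ?speed_itv_lty.
- by rewrite ge0_fin_numE ?speed_itv_lty.
- apply: le_measure; rewrite ?inE//; try exact: measurable_itv.
  by apply: subset_itv; rewrite bnd_simp.
Qed.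

Lemma edge_fun_continuous a b : {within E, continuous (edge_fun a b)}.
Proof.
apply/subspace_continuousP => x Ex.
have [c Ec xc] := on_edge_gt Ex; have [K K0 HK] := edge_fun_lipschitz a b Ec.
have := @scale_continuous _ _ D e.
move=> /subspace_continuousP/(_ x Ex)/cvgrPdist_le hs.
apply/cvgrPdist_le => r r0; have := hs (r / K) (divr_gt0 r0 K0).
rewrite !near_withinE => {}hs; near=> y => Ey.
have yc : y <= c by apply: ltW; near: y; exact: lt_nbhsl.
have x0 : 0 <= x by case: Ex.
have y0 : 0 <= y by case: Ey.
have : `|s x - s y| <= r / K by move: Ey; near: y; exact: hs.
rewrite ler_pdivlMr// mulrC.
apply: le_trans.
have [xy|/ltW yx] := leP x y.
  by rewrite distrC (distrC (s x)) (ger0_norm (_ : 0 <= s y - s x)) ?subr_ge0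
    ?scale_le// HK.
by rewrite (ger0_norm (_ : 0 <= s x - s y)) ?subr_ge0 ?scale_le// HK// ltW.
Unshelve. all: by end_near. Qed.

Lemma edge_fun0 a b : edge_fun a b 0 = a.
Proof.
rewrite /edge_fun scale0 mulr0 addr0.
by rewrite set_itv_ge ?bnd_simp ?ltxx// Rintegral_set0 addr0.
Qed.

Lemma edge_slope0 b : edge_slope b 0 = b.
Proof.
by rewrite /edge_slope set_itv_ge ?bnd_simp ?ltxx// Rintegral_set0 addr0.
Qed.

End edge_solution.

(** * Cutoff functions and bounded solutions on one edge *)

Section cutoff.
Context (R : realType) (G : star_graph R) (D : diffusion_data G) (e : edge G).
Local Notation s := (scale D e).
Local Notation m := (speed D e).
Local Notation E := (@on_edge R G e).
Context (u v : R).
Hypothesis uv : u < v.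

Definition cutoff (x : R) : R := Num.max 0 (Num.min 1 ((v - x) / (v - u))).

Lemma cutoff_continuous : continuous cutoff.
Proof.
move=> x; suff : {for x, continuous ((cst 0 : R -> R^o) \max
    ((cst 1 : R -> R^o) \min (fun y => (v - y) / (v - u))))} by [].
apply: continuous_max; first exact: cvg_cst.
apply: continuous_min; first exact: cvg_cst.
by apply: cvgM; [apply: cvgB; [exact: cvg_cst|exact: cvg_id]|exact: cvg_cst].
Qed.

Lemma cutoff_itv x : 0 <= cutoff x <= 1.
Proof. by rewrite /cutoff le_max lexx/= ge_max ler01 ge_min lexx. Qed.

Lemma cutoff1 x : x <= u -> cutoff x = 1.
Proof.
move=> xu; rewrite /cutoff min_l; first by rewrite max_r.
by rewrite ler_pdivlMr ?subr_gt0// mul1r lerD2l lerN2.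
Qed.

Lemma cutoff0 x : v <= x -> cutoff x = 0.
Proof.
move=> vx; rewrite /cutoff max_l// ge_min; apply/orP; right.
by rewrite ler_pdivrMr ?subr_gt0// mul0r subr_le0.
Qed.

Lemma cutoff_mid x : u + (v - u) / 4 <= x <= u + (v - u) * 3 / 4 ->
  1 / 4 <= cutoff x <= 3 / 4.
Proof.
move=> /andP[ux xv]; have vu : 0 < v - u by rewrite subr_gt0.
have H : 1 / 4 <= (v - x) / (v - u) <= 3 / 4.
  by rewrite ler_pdivlMr// ler_pdivrMr//; apply/andP; split; lra.
by rewrite /cutoff min_r ?max_r//; lra.
Qed.

(** Continuous, non-negative and zero outside ]u, v[: adding a multiple of it to the right-hand side
    adjusts the slope at [v] without touching [0, u]. *)
Definition bump (x : R) : R := cutoff x * (1 - cutoff x).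

Lemma bump_continuous : continuous bump.
Proof.
move=> x; apply: cvgM; first exact: cutoff_continuous.
by apply: cvgB; [exact: cvg_cst|exact: cutoff_continuous].
Qed.

Lemma bump_itv x : 0 <= bump x <= 1.
Proof. by rewrite /bump; have := cutoff_itv x; move=> /andP[? ?]; apply/andP;
  split; nra. Qed.

(** On the middle half of ]u, v[ the cutoff lies in [1/4, 3/4], so the bump is at least 1/4 * 3/4 =
    3/16 there, and the speed charges every open interval. *)
Lemma Rintegral_bump_gt0 : 0 <= u -> E v -> 0 < \int[m]_(z in `]0, v]%classic)
  bump z.
Proof.
move=> u0 Ev; set x1 := u + (v - u) / 4; set x2 := u + (v - u) * 3 / 4.
have vu := uv; have [ux1 x12 x2v] : [/\ u < x1, x1 < x2 & x2 < v].
  by rewrite /x1 /x2; split; lra.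
have x10 : 0 <= x1 by rewrite (le_trans u0)// ltW.
have x20 : 0 <= x2 by rewrite (le_trans x10)// ltW.
have Ex2 : E x2 by apply: on_edge_le (ltW x2v) Ev.
have Ex1 : E x1 by apply: on_edge_le (ltW x12) Ex2.
have bi x y : 0 <= x -> E y -> m.-integrable `]x, y]%classic (EFin \o bump).
  move=> x0 Ey; apply: (@integrable_speed _ _ _ _ bump 1) => //.
    exact: bump_continuous.
  by move=> z; have /andP[b0 b1] := bump_itv z; rewrite ger0_norm.
have b0 x y : 0 <= \int[m]_(z in `]x, y]%classic) bump z.
  by apply: Rintegral_ge0 => z _; case/andP: (bump_itv z).
rewrite (@Rintegral_speed_cat _ _ _ _ _ x2) ?(ltW x2v)//; [|exact: bi].
rewrite (@Rintegral_speed_cat _ _ _ _ _ x1) ?(ltW x12)//; [|exact: bi].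
suff : 0 < \int[m]_(z in `]x1, x2]%classic) bump z.
  by have := b0 0 x1; have := b0 x2 v; lra.
have mx : (m `]x1, x2]%classic < +oo)%E by exact: speed_itv_lty.
apply: (@lt_le_trans _ _ (\int[m]_(z in `]x1, x2]%classic) (3 / 16))).
  rewrite Rintegral_cst//; apply: mulr_gt0; first by rewrite divr_gt0.
  rewrite fine_gt0// mx andbT; apply: lt_le_trans (@speed_positive _ _ D e _ _
    Ex1 Ex2 x12) _.
  apply: le_measure; rewrite ?inE//; try exact: measurable_itv.
  by apply: subset_itvl; rewrite bnd_simp.
apply: le_Rintegral => //.
- by apply: (@bounded_integrable _ _ _ _ _ (cst (3 / 16)) `|3 / 16|).
- by apply: bi => //; lra.
- move=> z; rewrite /= in_itv/= => /andP[z1 z2].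
  have /andP[c1 c2] : 1 / 4 <= cutoff z <= 3 / 4.
    by apply: cutoff_mid; apply/andP; split=> //; exact: ltW.
  by rewrite /bump; nra.
Qed.

End cutoff.

(** The right-hand side is [k] on [0, u] and 0 from some [v > u] on. In between it is corrected so
    that the slope vanishes at [v]; the solution is then constant past [v], hence bounded whatever
    the scale does. *)
Lemma edge_solution_exists (R : realType) (G : star_graph R) (D :
  diffusion_data G)
    (e : edge G) (a b k u : R) : 0 < u -> (u%:E < len e)%E ->
  exists2 fFh : (R -> R) * (R -> R) * (R -> R), let: (f, F, h) := fFh in
    [/\ is_Dscale (@on_edge R G e) (scale D e) f F,
        is_Dspeed (@on_edge R G e) (speed D e) F h,
        {within @on_edge R G e, continuous f} & continuous h] &
    let: (f, F, h) := fFh in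
    [/\ f 0 = a, F 0 = b, forall x, 0 <= x <= u -> h x = k,
        forall x, 0 <= x <= u -> k = 0 -> f x = a + b * scale D e x &
        exists M, forall x, on_edge e x -> `|f x| <= M /\ `|h x| <= M].
Proof.
move=> u0 ul; have Eu : on_edge e u by split=> //; exact: ltW.
have [v Ev uv] := on_edge_gt Eu.
set s := scale D e; set m := speed D e.
set I1 := \int[m]_(z in `]0, v]%classic) cutoff u v z.
set I2 := \int[m]_(z in `]0, v]%classic) bump u v z.
have I20 : 0 < I2 by apply: Rintegral_bump_gt0 => //; exact: ltW.
(* Solves b + k I1 - c I2 = 0, the left side being the slope at [v]. *)
set c := (b + k * I1) / I2.
pose h x := k * cutoff u v x - c * bump u v x.
have ch : continuous h.
  move=> x; apply: cvgB; apply: cvgM; try exact: cvg_cst.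
    exact: cutoff_continuous.
  exact: bump_continuous.
have hM x : `|h x| <= `|k| + `|c|.
  rewrite (le_trans (ler_normB _ _))// lerD// normrM ler_piMr// ger0_norm.
  - by case/andP: (cutoff_itv u v x).
  - by case/andP: (cutoff_itv u v x).
  - by case/andP: (bump_itv u v x).
  - by case/andP: (bump_itv u v x).
have hk x : 0 <= x <= u -> h x = k.
  by move=> /andP[_ xu]; rewrite /h /bump cutoff1// subrr !mulr0 subr0 mulr1.
have h0 x : v <= x -> h x = 0.
  by move=> vx; rewrite /h /bump cutoff0// mul0r !mulr0 subr0.
have ci : m.-integrable `]0, v]%classic (EFin \o cutoff u v).
  apply: (@integrable_speed _ _ _ _ _ 1) => //; first exact: cutoff_continuous.
  by move=> z; have /andP[c0 c1] := cutoff_itv u v z; rewrite ger0_norm.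
have bi : m.-integrable `]0, v]%classic (EFin \o bump u v).
  apply: (@integrable_speed _ _ _ _ _ 1) => //; first exact: bump_continuous.
  by move=> z; have /andP[c0 c1] := bump_itv u v z; rewrite ger0_norm.
have Fv : edge_slope D e h b v = 0.
  rewrite /edge_slope /h RintegralB//; last 2 first.
    by have := @integrableZl _ _ _ m _ (measurable_itv _) k _ ci; apply.
    by have := @integrableZl _ _ _ m _ (measurable_itv _) c _ bi; apply.
  rewrite !RintegralZl// -/I1 -/I2 /c; field; exact: lt0r_neq0.
exists (edge_fun D e h a b, edge_slope D e h b, h) => /=.
  split=> //.
  - exact: is_Dscale_edge_fun ch hM _ _.
  - exact: is_Dspeed_edge_slope ch hM _.
  - exact: edge_fun_continuous ch hM _ _.
split=> //.
- exact: edge_fun0.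
- exact: edge_slope0.
- move=> x /andP[x0 xu] k0; rewrite /edge_fun (@eq_Rintegral _ _ _ _ _ (fun=>
  0)).
    by rewrite Rintegral_cst// mul0r addr0.
  move=> z; rewrite inE/= in_itv/= => /andP[z0 zx].
  by rewrite hk ?k0 ?mulr0// (ltW z0) (le_trans zx xu).
- have [K K0 HK] := edge_fun_lipschitz D ch hM a b Ev.
  have sv : 0 <= s v by rewrite ltW// scale_gt0//; lra.
  have B x : 0 <= x <= v -> `|edge_fun D e h a b x| <= `|a| + K * s v.
    move=> /andP[x0 xv]; have Ex := on_edge_le x0 xv Ev.
    have := HK _ _ (lexx 0) x0 xv; rewrite edge_fun0 scale0 subr0 => H.
    rewrite -[X in `|X|](subrK a) addrC (le_trans (ler_normD _ _))// lerD2l.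
    by rewrite (le_trans H)// ler_pM2l// scale_le.
  exists (`|a| + K * s v + (`|k| + `|c|)) => x Ex; split; last first.
    by rewrite (le_trans (hM x))// lerDr addr_ge0// mulr_ge0// ltW.
  apply: (@le_trans _ _ (`|a| + K * s v)); last by rewrite lerDl addr_ge0.
  have [xv|vx] := leP x v; first by apply: B; rewrite xv; case: Ex => ->.
  (* Expansion at [v]: the slope is zero there and [h] is zero beyond, so f(x) = f(v). *)
  have := edge_funB D ch hM a b Ev Ex (ltW vx).
  rewrite Fv mulr0 add0r (@eq_Rintegral _ _ _ _ _ (fun=> 0)).
    rewrite Rintegral_cst// mul0r => /subr0_eq ->; apply: B;
      rewrite lexx andbT; lra.
  move=> z; rewrite inE/= in_itv/= => /andP[vz zx].
  by rewrite h0 ?mulr0// ltW.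
Qed.

(** * The star graph *)

Section rays.
Context (R : realType) (G : star_graph R).
Implicit Types (p q : star G) (e : edge G).

(** Retraction of the star onto the edge [e], the other edges collapsing to the vertex. The
    arbitrary label of the vertex is harmless, its coordinate being 0. Unlike [label], this map is
    continuous. *)
Definition ray e p : R := if label p == e then coord p else 0.

Lemma on_edge_ray e p : on_edge e (ray e p).
Proof.
rewrite /ray; case: eqVneq => [<-|_]; last by split; rewrite ?len_gt0.
by split; [exact: coord_ge0|exact: coord_label].
Qed.

Lemma ray_lipschitz e p q : `|ray e p - ray e q| <= geodist p q.
Proof.
rewrite /geodist /ray; have p0 := coord_ge0 p; have q0 := coord_ge0 q.
have [pe|pe] := eqVneq (label p) e; have [qe|qe] := eqVneq (label q) e.
- by rewrite pe qe eqxx.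
- by rewrite pe eq_sym (negbTE qe) subr0 ger0_norm// lerDl.
- by rewrite qe (negbTE pe) sub0r normrN ger0_norm// lerDr.
- by rewrite subrr normr0; case: ifP => _ //; exact: addr_ge0.
Qed.

Lemma ray_continuous e : continuous (ray e).
Proof.
move=> p; apply/(@cvgrPdist_lt _ _ _ (nbhs p) (nbhs_filter p)) => r r0;
  apply/nbhs_ballP; exists r => // q pq /=.
exact: le_lt_trans (ray_lipschitz e p q) pq.
Qed.

Lemma sum_ray (V : nmodType) (f : edge G -> R -> V) p : (forall e, f e 0 = 0) ->
  \sum_e f e (ray e p) = f (label p) (coord p).
Proof.
move=> f0; rewrite (bigD1 (label p))//= {1}/ray eqxx big1 ?addr0// => e ne.
by rewrite /ray eq_sym (negbTE ne).
Qed.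

(** At the vertex the label is arbitrary, so the gluing is meaningful when all [f e 0] agree, as the
    lemmas below assume. *)
Definition star_fun (f : edge G -> R -> R) p : R := f (label p) (coord p).

Lemma star_fun_pt (f : edge G -> R -> R) a e x :
  (forall e, f e 0 = a) -> on_edge e x -> star_fun f (pt e x) = f e x.
Proof.
move=> fa ex; rewrite /star_fun coord_pt//; have [->|x0] := eqVneq x 0.
  by rewrite !fa.
by rewrite label_pt.
Qed.

(** After subtracting the common value [a], the function is the sum over the edges of its
    restrictions composed with the retractions [ray e], all but one of these terms vanishing at each
    point. *)
Lemma star_fun_continuous (f : edge G -> R -> R) a :
  (forall e, f e 0 = a) -> (forall e, {within @on_edge R G e, continuous (f
    e)}) ->
  continuous (star_fun f).
Proof.
move=> fa fc.
have -> : star_fun f = fun p => a + \sum_e (f e (ray e p) - a).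
  apply/funext => p; rewrite (@sum_ray _ (fun e x => f e x - a)) => [|e].
    by rewrite addrC subrK.
  by rewrite fa subrr.
move=> p; have nF := nbhs_filter p; apply: cvgD; first exact: cvg_cst.
apply: cvg_big => [|e _]; first exact: add_continuous.
apply: cvgB; last exact: cvg_cst.
have /subspace_continuousP/(_ _ (on_edge_ray e p)) := fc e.
(* [f e] is continuous only within the edge; the retraction takes its values there. *)
apply: (@cvg_comp _ _ _ (ray e) (f e) (nbhs p)
  (within (@on_edge R G e) (nbhs (ray e p)))) => A wA.
have := ray_continuous wA.
by rewrite nbhs_simpl/=; apply: filterS => q /=; apply; exact: on_edge_ray.
Qed.

Context (u : edge G -> R).
Hypothesis hu : forall e, 0 < u e /\ ((u e)%:E < len e)%E.

(** A continuous gauge: the neighbourhood is the set where it is below 1, and it equals 1 exactly at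
    the points (e, u_e). Being inside or at the boundary becomes a condition on one real
    function. *)
Definition ratio : star G -> R := star_fun (fun e x => x / u e).

Lemma ratio_continuous : continuous ratio.
Proof.
have f0 e : 0 / u e = 0 by rewrite mul0r.
apply: (@star_fun_continuous (fun e x => x / u e) 0 f0 _) => e.
apply: continuous_subspaceT => x; apply: cvgM; [exact: cvg_id|exact: cvg_cst].
Qed.

Lemma star_nbhdE p : star_nbhd u p <-> ratio p < 1.
Proof.
have u0 e : 0 < u e by case: (hu e).
split=> [[e _ [x /=]]|].
  rewrite in_itv/= => /andP[x0 xu] <-.
  rewrite /ratio (@star_fun_pt _ 0)//; last 2 first.
    by move=> e'; rewrite mul0r.
    by split=> //; apply: lt_trans (hu e).2; rewrite lte_fin.
  by rewrite ltr_pdivrMr// mul1r.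
rewrite /ratio /star_fun ltr_pdivrMr// mul1r => pu.
exists (label p) => //; exists (coord p); last exact: ptK.
by rewrite /= in_itv/= coord_ge0.
Qed.

End rays.

(** * Test functions in the domain of the generator *)

Lemma rquotient_comp (R : realType) (f s : R -> R) (F0 : R) :
  (\forall x \near 0^'+, s x != s 0) ->
  (f y - f 0) / (s y - s 0) @[y --> 0^'+] --> F0 -> rderivable s 0 ->
  rquotient f 0 x @[x --> 0^'+] --> F0 * rderiv s 0.
Proof.
move=> s0 fF ds.
have hs : rquotient s 0 x @[x --> 0^'+] --> rderiv s 0 by exact: ds.
apply: cvg_trans (cvgM fF hs); apply: near_eq_cvg; near=> x.
rewrite /rquotient/= /GRing.mul_fun/= add0r mulrA divfK// subr_eq0.
by near: x.
Unshelve. all: by end_near. Qed.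

Section star_solution.
Context (R : realType) (G : star_graph R) (D : diffusion_data G).
Context (u : edge G -> R).
Hypothesis hu : forall e, 0 < u e /\ ((u e)%:E < len e)%E.

(** [k] is the value of D_m D_s f on the neighbourhood, twice that of Lf. Since D_s f = b_e at 0,
    the derivative of f along [e] at the vertex is b_e s_e'(0), so the hypothesis is the vertex
    condition. *)
Lemma star_solution_exists (a : R) (b : edge G -> R) (k : R) :
  \sum_(e : edge G) bias D e * (b e * rderiv (scale D e) 0) = stickiness D * (k
    / 2) ->
  exists f g, [/\ diffusion_op D f g,
    forall p, ratio u p <= 1 -> g p = k / 2 &
    k = 0 -> forall e x, 0 <= x <= u e -> f (pt e x) = a + b e * scale D e x].
Proof.
move=> hb.
have H : forall e : edge G, exists z : (R -> R) * (R -> R) * (R -> R) * R,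
  [/\ is_Dscale (@on_edge R G e) (scale D e) z.1.1.1 z.1.1.2,
      is_Dspeed (@on_edge R G e) (speed D e) z.1.1.2 z.1.2,
      {within @on_edge R G e, continuous z.1.1.1} & continuous z.1.2] /\
  [/\ z.1.1.1 0 = a, z.1.1.2 0 = b e, forall x, 0 <= x <= u e -> z.1.2 x = k,
      forall x, 0 <= x <= u e -> k = 0 -> z.1.1.1 x = a + b e * scale D e x &
      forall x, on_edge e x -> `|z.1.1.1 x| <= z.2 /\ `|z.1.2 x| <= z.2].
  move=> e; have [u0 ul] := hu e.
  case: (edge_solution_exists D a (b e) k u0 ul) => -[[f F] h] /= H1 [H2 H3 H4
    H5 [M HM]].
  by exists (f, F, h, M).
have {H} [z Hz] := choice H.
pose fe (e : edge G) := (z e).1.1.1.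
pose ge (e : edge G) x := (z e).1.2 x / 2.
have fa e : fe e 0 = a by case: (Hz e) => _ [].
have gk e : ge e 0 = k / 2.
  by rewrite /ge; case: (Hz e) => _ [_ _ ->]//; rewrite lexx ltW//;
    case: (hu e).
have zM e : (z e).2 <= \sum_(e : edge G) `|(z e).2|.
  rewrite (bigD1 e)//= (le_trans (ler_norm _))// lerDl.
  by apply: sumr_ge0.
have fE e x : on_edge e x -> star_fun fe (pt e x) = fe e x by exact:
  star_fun_pt fa.
have near_edge (e : edge G) x : on_edge e x -> \forall y \near x^'+, on_edge e
  y.
  move=> ex; have [y ey xy] := on_edge_gt ex; near=> t.
  apply: on_edge_le ey; first by case: ex => x0 _; rewrite (le_trans x0)//.
  by near: t; exact: nbhs_right_le.
exists (star_fun fe), (star_fun ge); split.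
- split.
  + split; first by apply: star_fun_continuous fa _ => e; case: (Hz e) => -[].
    exists (\sum_(e : edge G) `|(z e).2|) => p; apply: le_trans (zM (label p)).
    case: (Hz (label p)) => _ [_ _ _ _]; case/(_ (coord p)) => //.
    by split; [exact: coord_ge0|exact: coord_label].
  + split.
      apply: star_fun_continuous gk _ => e; apply: continuous_subspaceT => x.
      by apply: cvgM; [case: (Hz e) => -[_ _ _ cz] _; exact: cz|exact: cvg_cst].
    exists (\sum_(e : edge G) `|(z e).2|) => p; apply: le_trans (zM (label p)).
    case: (Hz (label p)) => _ [_ _ _ _]; case/(_ (coord p)) => [|_].
      by split; [exact: coord_ge0|exact: coord_label].
    apply: le_trans; rewrite /star_fun /ge normrM ler_piMr//.
    by rewrite ger0_norm ?invr_ge0//; lra.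
  + move=> e; exists (z e).1.1.2, (z e).1.2; case: (Hz e) => -[h1 h2 _ _] _;
    split=> //.
    * move=> x ex; have := h1 x ex; apply: cvg_trans.
      apply: near_eq_cvg; near=> y; rewrite !fE//.
      by near: y; exact: near_edge.
    * by move=> x ex; rewrite (star_fun_pt gk).
  + have e0 (e : edge G) : on_edge e 0 by exact: on_edge0.
    have dF e : rquotient (fun x => star_fun fe (pt e x)) 0 x @[x --> 0^'+] -->
        b e * rderiv (scale D e) 0.
      apply: rquotient_comp; last exact: scale_rderivable0.
        near=> x; rewrite gt_eqF//; apply: scale_increasing => //.
        by near: x; exact: near_edge.
      case: (Hz e) => -[h1 _ _ _] [_ <- _ _ _]; have := h1 0 (e0 e);
        apply: cvg_trans.
      apply: near_eq_cvg; near=> y; rewrite !fE//.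
      by near: y; exact: near_edge.
    split=> [e|]; first by apply/cvg_ex; exists (b e * rderiv (scale D e) 0);
      exact: dF.
    rewrite -(pt0 ord0) (star_fun_pt gk)// gk -hb; apply: eq_bigr => e _.
    by congr (_ * _); apply/cvg_lim => //; exact: dF.
- move=> p; rewrite /ratio /star_fun ler_pdivrMr ?mul1r;
  last by case: (hu (label p)).
  move=> pu; rewrite /ge; case: (Hz (label p)) => _ [_ _ -> //]. 
  by rewrite coord_ge0.
- move=> k0 e x /andP[x0 xu]; rewrite fE; last first.
    by split=> //; apply: le_lt_trans (hu e).2; rewrite lee_fin.
  by rewrite /fe; case: (Hz e) => _ [_ _ _ -> //]; rewrite x0.
Unshelve. all: by end_near. Qed.

End star_solution.

(** * The Markov property *)

Section restricted_measure.
Context d (T : measurableType d) (R : realType) (mu : probability T R).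
Context (A : set T) (mA : measurable A).

Let restr_le1 : (mrestr mu mA setT <= 1)%E.
Proof. by rewrite /mrestr setTI probability_le1. Qed.

HB.instance Definition _ :=
  Measure_isSubProbability.Build _ _ _ (mrestr mu mA) restr_le1.

(** Expectations over an event [A] become integrals against a sub-probability, so that the
    push-forward and composition rules of the Giry monad apply to them. *)
Definition giry_restr : giry T R := mrestr mu mA.

Lemma ge0_integral_giry_restr (f : T -> \bar R) :
  measurable_fun setT f -> (forall x, 0 <= f x)%E ->
  (\int[giry_restr]_x f x = \int[mu]_(x in A) f x)%E.
Proof.
move=> mf f0; rewrite (@ge0_negligible_integral _ _ _ giry_restr setT (~`
  A))//; last 2 first.
  exact: measurableC.
  by rewrite /giry_restr/= /mrestr setICl measure0.
rewrite setTD setCK; apply: eq_measure_integral => B mB BA.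
by rewrite /giry_restr/= /mrestr setIidl.
Qed.

End restricted_measure.

Section markov.
Context (R : realType) (G : star_graph R) (D : diffusion_data G).
Context (d : measure_display) (Omega : measurableType d).
Context (F : R -> set (set Omega)) (P : star G -> probability Omega R).
Context (X : R -> Omega -> star G).
Hypothesis hX : general_diffusion D F P X.
Local Notation S := (borel_star G).

Lemma filtration_measurable t A : 0 <= t -> F t A -> measurable A.
Proof. by case: (gd_filtration hX) => _ H _ t0; exact: H. Qed.

Lemma filtration_le s t A : 0 <= s -> s <= t -> F s A -> F t A.
Proof. by case: (gd_filtration hX) => _ _ H s0 st; exact: H. Qed.

Lemma measurable_process t : 0 <= t -> measurable_fun setT (X t : Omega -> S).
Proof.
move=> t0 _ B mB; rewrite setTI; apply: (@filtration_measurable t) => //.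
exact: gd_adapted hX _ _ _ _.
Qed.

Lemma continuous_measurable_star (f : star G -> R) :
  continuous f -> measurable_fun setT (f : S -> R).
Proof.
move=> cf; apply: (measurability _ (RGenOpens.measurableE R)).
move=> /= _ [_ [a [b ->]] <-]; rewrite setTI; apply: sub_sigma_algebra.
by move/continuousP : cf; apply; exact: interval_open.
Qed.

Lemma measurable_fun_process (f : star G -> R) t : 0 <= t -> continuous f ->
  measurable_fun setT (fun w => f (X t w)).
Proof.
move=> t0 cf; apply: measurableT_comp (continuous_measurable_star cf) _.
exact: measurable_process.
Qed.

Definition law t (t0 : 0 <= t) (q : S) : giry S R :=
  giry_map (measurable_process t0) (P q).

Lemma measurable_law t (t0 : 0 <= t) : measurable_fun setT (law t0).
Proof.
apply: measurable_giry_codensity => // B mB.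
exact: gd_kernel hX _ _ t0 mB.
Qed.

(** The strong Markov property at the constant stopping time [t]. *)
Lemma simple_markov p t s (A : set Omega) (B : set S) : 0 <= t -> 0 <= s -> F t
  A ->
  measurable B ->
  (P p (A `&` X (t + s) @^-1` B) = \int[P p]_(w in A) P (X t w) (X s @^-1`
    B))%E.
Proof.
move=> t0 s0 FA mB.
have sT : stopping_time F (fun=> t%:E).
  split=> [_|r r0]; first by rewrite lee_fin.
  have [sa _ _] := gd_filtration hX; have [F0 FC _] := sa r r0.
  have [tr|rt] := leP t r.
    rewrite (_ : [set w | _] = setT `\` set0); first exact: FC.
    by rewrite setD0; apply/seteqP; split=> w //= _; rewrite lee_fin.
  rewrite (_ : [set w | _] = set0)//.
  by apply/seteqP; split=> w //=; rewrite lee_fin leNgt rt.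
have sA : stopped_events F (fun=> t%:E) A.
  split; first exact: filtration_measurable FA.
  move=> r r0; have [sa _ _] := gd_filtration hX; have [F0 FC _] := sa r r0.
  have [tr|rt] := leP t r.
    rewrite (_ : [set w | _] = setT); first by rewrite setIT;
      exact: filtration_le FA.
    by apply/seteqP; split=> w //= _; rewrite lee_fin.
  rewrite (_ : [set w | _] = set0) ?setI0//.
  by apply/seteqP; split=> w //=; rewrite lee_fin leNgt rt.
have := gd_strong_markov hX p sT sA s0 mB.
rewrite (_ : [set w | (t%:E < +oo)%E /\ B (X (fine t%:E + s) w)] = X (t + s)
  @^-1` B).
  rewrite (_ : [set w : Omega | (t%:E < +oo)%E] = setT) ?setIT//.
  by apply/seteqP; split=> w //= _; rewrite ltry.
by apply/seteqP; split=> w /=; [case|split=> //; rewrite ltry].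
Qed.

(** Both sides integrate [f] against a measure on the star: the image under [X (t + s)] of the
    measure restricted to [A], and the composition of that measure with the kernel [law]. By
    [simple_markov] the two measures agree on Borel sets. *)
Lemma ge0_markov p t s (A : set Omega) (f : S -> \bar R) : 0 <= t -> 0 <= s ->
  F t A ->
  measurable_fun setT f -> (forall q, 0 <= f q)%E ->
  (\int[P p]_(w in A) f (X (t + s) w) =
   \int[P p]_(w in A) \int[P (X t w)]_w' f (X s w'))%E.
Proof.
move=> t0 s0 FA mf f0; have mA := filtration_measurable t0 FA.
have ts0 : 0 <= t + s by exact: addr_ge0.
have mXf r : 0 <= r -> measurable_fun setT (fun w => f (X r w)).
  by move=> r0; apply: measurableT_comp mf _; exact: measurable_process.
have mk : measurable_fun setT (fun w => law s0 (X t w)).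
  by apply: measurableT_comp (measurable_law s0) _; exact: measurable_process.
rewrite -(ge0_integral_giry_restr (P p) mA); [|exact: mXf|by []].
have -> : (\int[giry_restr (P p) mA]_w f (X (t + s) w) =
    giry_int (giry_map (measurable_process ts0) (giry_restr (P p) mA)) f)%E.
  by rewrite giry_int_map.
rewrite /giry_int (@eq_measure_integral _ _ _ _ (giry_bind (giry_restr (P p)
  mA) mk)).
  rewrite -/(giry_int _ _) giry_int_bind// /giry_int ge0_integral_giry_restr.
  - apply: eq_integral => w _; rewrite -/(giry_int _ _) /law giry_int_map//.
  - exact: (measurableT_comp (measurable_giry_int mf f0) mk).
  - by move=> w; apply: integral_ge0.
move=> B mB _; transitivity (P p (A `&` X (t + s) @^-1` B));
  first by rewrite setIC.
rewrite simple_markov//.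
rewrite /giry_bind/= /giry_join/= giry_int_map//;
  last exact: measurable_giry_ev.
rewrite /giry_int ge0_integral_giry_restr//.
exact: (measurableT_comp (measurable_giry_ev mB) mk).
Qed.

Section bounded_function.
Context (f : star G -> R) (M : R).
Hypotheses (cf : continuous f) (fM : forall q, `|f q| <= M).

Lemma integrable_process p t A : 0 <= t -> measurable A ->
  (P p).-integrable A (EFin \o (fun w => f (X t w))).
Proof.
move=> t0 mA; apply: (@bounded_integrable _ _ _ _ _ _ M) => //.
- by rewrite (le_lt_trans (probability_le1 _ _))// ltry.
- by apply: measurable_funTS; exact: measurable_fun_process.
Qed.

Lemma semigroup_bound t q : 0 <= t -> `|semigroup P X t f q| <= M.
Proof.
move=> t0; have PT : P q setT = 1%E by exact: probability_setT.
rewrite -[M]mulr1 -[X in _ * X]/(fine 1%E) -PT; apply: norm_Rintegral_le => //.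
- by rewrite (le_lt_trans (probability_le1 _ _))// ltry.
- exact: measurable_fun_process.
Qed.

(** A function bounded by [M] is treated through [f + M >= 0], and the constant is subtracted at the
    end. *)
Let shift q : (f q + M)%:E = ((f q)%:E + M%:E)%E. Proof. by []. Qed.

Let shift_ge0 q : (0 <= (f q + M)%:E)%E.
Proof. by rewrite lee_fin; have := fM q; rewrite ler_norml => /andP[? _];
  lra. Qed.

Let measurable_shift : measurable_fun setT (fun q : S => (f q + M)%:E).
Proof.
apply/measurable_EFinP; apply: measurable_funD => //.
exact: continuous_measurable_star.
Qed.

Let semigroup_shift t q : 0 <= t ->
  (\int[P q]_w (f (X t w) + M)%:E)%E = (semigroup P X t f q + M)%:E.
Proof.
move=> t0; under eq_integral do rewrite shift.
rewrite integralD//; last 2 first.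
  exact: integrable_process.
  exact: finite_measure_integrable_cst.
rewrite integral_cst//= probability_setT mule1 EFinD /semigroup /Rintegral
  fineK//.
by apply: integrable_fin_num => //; exact: integrable_process.
Qed.

Lemma measurable_semigroup t : 0 <= t -> measurable_fun setT (semigroup P X t f
  : S -> R).
Proof.
move=> t0; apply/measurable_EFinP.
rewrite (_ : EFin \o _ = (fun q : S => giry_int (law t0 q) (fun q => (f q +
  M)%:E) - M%:E)%E).
  apply: emeasurable_funB => //.
  exact: (measurableT_comp (measurable_giry_int measurable_shift shift_ge0)
    (measurable_law t0)).
apply/funext => q /=; rewrite giry_int_map//.
have -> : giry_int (P q) _ = (semigroup P X t f q + M)%:E := semigroup_shift q
  t0.
by rewrite EFinD addeK.
Qed.

Lemma integrable_semigroup p t s A : 0 <= t -> 0 <= s -> measurable A ->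
  (P p).-integrable A (EFin \o (fun w => semigroup P X s f (X t w))).
Proof.
move=> t0 s0 mA; apply: (@bounded_integrable _ _ _ _ _ _ M) => //.
- by rewrite (le_lt_trans (probability_le1 _ _))// ltry.
- apply: measurable_funTS; apply: measurableT_comp (measurable_semigroup s0) _.
  exact: measurable_process.
- by move=> w _; exact: semigroup_bound.
Qed.

Lemma markov p t s A : 0 <= t -> 0 <= s -> F t A ->
  \int[P p]_(w in A) f (X (t + s) w) = \int[P p]_(w in A) semigroup P X s f (X
    t w).
Proof.
move=> t0 s0 FA; have mA := filtration_measurable t0 FA.
have ts0 : 0 <= t + s by exact: addr_ge0.
have iM : (P p).-integrable A (cst M%:E) by exact:
  finite_measure_integrable_cst.
have := ge0_markov p t0 s0 FA measurable_shift shift_ge0.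
under eq_integral do rewrite shift.
rewrite integralD//; last exact: integrable_process.
under [in RHS]eq_integral do rewrite semigroup_shift// EFinD.
rewrite integralD//; last exact: integrable_semigroup.
have cfin : (\int[P p]_(w in A) M%:E)%E \is a fin_num by exact:
  integrable_fin_num.
by move=> H; congr fine; rewrite -[LHS](addeK _ cfin) H addeK.
Qed.

End bounded_function.

End markov.

(** The set of t where f has gained at least (c - e) (t - a) contains its supremum by the Lipschitz
    bound, and a right derivative above c - e pushes that supremum further as long as t < b. The
    slack e is there because the derivative may equal c. *)
Lemma mean_value_right (R : realType) (f g : R -> R) (a b c K : R) : a <= b ->
  (forall t h, a <= t -> 0 < h -> `|f (t + h) - f t| <= K * h) ->
  (forall t, a <= t < b -> (f (t + h) - f t) / h @[h --> 0^'+] --> g t) ->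
  (forall t, a <= t < b -> c <= g t) ->
  c * (b - a) <= f b - f a.
Proof.
move=> ab fK fg cg; apply/ler_addgt0Pr => _/posnumP[r].
have [->|nab] := eqVneq a b; first by rewrite !subrr mulr0 add0r.
have {}nab : a < b by rewrite lt_neqAle nab.
(* The slack accumulated over [a, b] is then exactly r. *)
set e := r%:num / (b - a).
have e0 : 0 < e by rewrite divr_gt0// subr_gt0.
suff : (c - e) * (b - a) <= f b - f a.
  by rewrite mulrBl /e divfK ?subr_eq0 ?gt_eqF// lerBlDr.
pose A := [set t | a <= t <= b /\ (c - e) * (t - a) <= f t - f a].
have Aa : A a by split; rewrite ?lexx ?ab// !subrr mulr0.
have Ab : ubound A b by move=> t [/andP[]].
have hs : has_sup A by split; [exists a|exists b].
set t := sup A.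
have at_ : a <= t by apply: ub_le_sup => //; case: hs.
have tb : t <= b by apply: ge_sup => //; case: hs.
have K0 : 0 <= K.
  by have := fK a 1 (lexx a) ltr01; rewrite mulr1; apply: le_trans.
have At : (c - e) * (t - a) <= f t - f a.
  apply/ler_addgt0Pr => _/posnumP[d].
  have dp : 0 < d%:num by [].
  (* Within this distance of the supremum, the variation of [f] and of the linear term is at most d
     in all; the 1 keeps the denominator positive. *)
  have d0 : 0 < d%:num / (K + `|c - e| + 1).
    by rewrite divr_gt0//; have := normr_ge0 (c - e); lra.
  have [s [/andP[as_ sb] As] st] := sup_adherent d0 hs.
  have st' : s <= t by apply: ub_le_sup; [case: hs|split=> //; rewrite as_].
  have [st0|st0] := eqVneq s t; first by rewrite -st0; have := As; lra.
  have {}st0 : 0 < t - s by rewrite subr_gt0 lt_neqAle st0.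
  have := fK s (t - s) as_ st0; rewrite subrKC ler_norml => /andP[f1 _].
  have : (t - s) * (K + `|c - e| + 1) <= d%:num.
    rewrite -ler_pdivlMr; last by have := normr_ge0 (c - e); lra.
    by rewrite -/t in st; lra.
  have : (c - e) * (t - s) <= `|c - e| * (t - s) by rewrite ler_wpM2r
    ?ler_norm// ltW.
  by move: As f1; nra.
have [bt|tb'] := leP b t; first by have -> : b = t by apply/eqP;
  rewrite eq_le bt tb.
have atb : a <= t < b by rewrite at_ tb'.
exfalso.
have cgt : c - e < g t by have := cg t atb; lra.
have : \forall h \near 0^'+, c - e < (f (t + h) - f t) / h.
  by apply: cvgr_gt (fg t atb) _ cgt.
move=> H.
suff [h [h0 hb hc]] : exists h, [/\ 0 < h, t + h <= b & c - e < (f (t + h) - f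
  t) / h].
  have : A (t + h).
    split; first by apply/andP; split=> //; lra.
    by move: hc; rewrite ltr_pdivlMr//; move: At; lra.
  move=> /(ub_le_sup (_ : has_ubound A)) => /(_ (proj2 hs)); rewrite -/t; lra.
near (0 : R)^'+ => h; exists h; split.
- by [].
- rewrite -lerBrDl; near: h; apply: nbhs_right_le; lra.
- by near: h.
Unshelve. all: by end_near. Qed.

Lemma bounded_cvg_Rintegral d (T : measurableType d) (R : realType)
    (mu : {measure set T -> \bar R}) (A : set T) (f_ : nat -> T -> R) (f : T ->
      R) (M : R) :
  measurable A -> (mu A < +oo)%E -> (forall n, measurable_fun A (f_ n)) ->
  measurable_fun A f -> (forall n x, A x -> `|f_ n x| <= M) ->
  (forall x, A x -> f_ n x @[n --> \oo] --> f x) ->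
  \int[mu]_(x in A) f_ n x @[n --> \oo] --> \int[mu]_(x in A) f x.
Proof.
move=> mA muA mf_ mf fM ff.
have fi : mu.-integrable A (EFin \o f).
  apply: (@bounded_integrable _ _ _ _ _ _ M) => // x Ax.
  have /cvg_norm fx := ff x Ax; rewrite -(cvg_lim (@Rhausdorff R) fx).
  by apply: limr_le; [exact: (cvgP _ fx)|by apply: nearW => n; exact: fM].
apply: fine_cvg; rewrite fineK; last exact: integrable_fin_num.
apply: (@dominated_cvg _ _ _ mu A mA _ _ (cst M%:E)) => //.
- by move=> n; exact/measurable_EFinP.
- by move=> x Ax; apply: cvg_EFin; [exact: nearW|exact: ff].
- by apply: (@bounded_integrable _ _ _ _ _ (cst M) `|M|).

Qed.

(** * Increments along the generator *)

Section generator_estimates.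
Context (R : realType) (G : star_graph R) (D : diffusion_data G).
Context (d : measure_display) (Omega : measurableType d).
Context (F : R -> set (set Omega)) (P : star G -> probability Omega R).
Context (X : R -> Omega -> star G).
Hypothesis hX : general_diffusion D F P X.
Context (f g : star G -> R).
Hypothesis hfg : generator P X f g.

(** The definition of the generator bounds the quotients only for [h] below some [r]; for larger [h]
    the bound 2M on the numerator gives 2M / r. *)
Lemma generator_bound : exists2 K, 0 <= K &
  forall h p, 0 < h -> `|(semigroup P X h f p - f p) / h| <= K.
Proof.
case: hfg => -[cf [M fM]] _ _ [K [r /= r0 hK]].
have M0 : 0 <= M by rewrite (le_trans _ (fM (vertex G))).
exists (`|K| + 2 * M / r) => [|h p h0];
  first by rewrite addr_ge0// divr_ge0 ?mulr_ge0// ltW.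
have [hr|rh] := ltP h r.
  have := hK h; rewrite /= sub0r normrN gtr0_norm// => /(_ hr h0 p) H.
  rewrite (le_trans H)// (le_trans (ler_norm K))// lerDl.
  by rewrite divr_ge0 ?mulr_ge0// ltW.
rewrite normrM normfV (gtr0_norm h0) ler_pdivrMr//.
apply: (@le_trans _ _ (2 * M)).
  rewrite mulrDl mul1r (le_trans (ler_normB _ _))// lerD//.
  by apply: (semigroup_bound hX cf fM); exact: ltW.
apply: (@le_trans _ _ (2 * M / r * h));
  last by rewrite ler_wpM2r ?(ltW h0)// lerDr.
by rewrite mulrAC ler_pdivlMr// ler_wpM2l// mulr_ge0.
Qed.

Context (p : star G) (a : R) (A : set Omega).
Hypotheses (a0 : 0 <= a) (FA : F a A).

Let mA : measurable A. Proof. exact: (filtration_measurable hX) FA. Qed.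

Let PA : (P p A < +oo)%E.
Proof. by rewrite (le_lt_trans (probability_le1 _ _))// ltry. Qed.

Lemma integral_incr t h : a <= t -> 0 < h ->
  (\int[P p]_(w in A) f (X (t + h) w) - \int[P p]_(w in A) f (X t w)) =
  \int[P p]_(w in A) (semigroup P X h f (X t w) - f (X t w)).
Proof.
case: hfg => -[cf [M fM]] _ _ _ at_ h0.
have t0 := le_trans a0 at_.
rewrite (markov hX cf fM)//; [|exact: ltW|exact: (filtration_le hX) FA].
rewrite RintegralB//; last exact: (integrable_process hX cf fM).
by apply: (integrable_semigroup hX cf fM) => //; exact: ltW.
Qed.

Lemma measurable_semigroup_process t h : a <= t -> 0 < h ->
  measurable_fun A (fun w => semigroup P X h f (X t w) - f (X t w)).
Proof.
case: hfg => -[cf [M fM]] _ _ _ at_ h0.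
have t0 := le_trans a0 at_.
apply: measurable_funTS; apply: measurable_funB;
  last exact: (measurable_fun_process hX).
apply: measurableT_comp (measurable_semigroup hX cf fM (ltW h0)) _.
exact: (measurable_process hX).
Qed.

Lemma integral_lipschitz : exists K, forall t h, a <= t -> 0 < h ->
  `|\int[P p]_(w in A) f (X (t + h) w) - \int[P p]_(w in A) f (X t w)| <= K * h.
Proof.
have [K K0 hK] := generator_bound; exists K => t h at_ h0;
  rewrite integral_incr//.
apply: (@le_trans _ _ (K * h * fine (P p A))).
  apply: norm_Rintegral_le => //; first exact: measurable_semigroup_process.
  by move=> w _; have := hK h (X t w) h0;
    rewrite normrM normfV (gtr0_norm h0) ler_pdivrMr.
rewrite ler_piMr ?mulr_ge0 ?(ltW h0)//.
by rewrite -lee_fin fineK ?probability_le1// ge0_fin_numE.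
Qed.

(** Bounded convergence along sequences decreasing to 0, with the uniform bound on the quotients as
    dominating constant. *)
Lemma integral_derive t : a <= t ->
  (\int[P p]_(w in A) f (X (t + h) w) - \int[P p]_(w in A) f (X t w)) / h
    @[h --> 0^'+] --> \int[P p]_(w in A) g (X t w).
Proof.
move=> at_; have t0 := le_trans a0 at_.
have [K K0 hK] := generator_bound.
case: hfg => -[cf [M fM]] [cg _] gen _.
apply/cvg_at_rightP => v [v0 vc].
rewrite (_ : (fun n => _) = (fun n => \int[P p]_(w in A)
    ((semigroup P X (v n) f (X t w) - f (X t w)) / v n))); last first.
  apply/funext => n; rewrite integral_incr// RintegralZr//.
  apply: (@bounded_integrable _ _ _ _ _ _ (K * v n)) => //.
    exact: measurable_semigroup_process.
  by move=> w _; have := hK (v n) (X t w) (v0 n);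
    rewrite normrM normfV (gtr0_norm (v0 n)) ler_pdivrMr.
apply: (@bounded_cvg_Rintegral _ _ _ _ _ _ _ K) => //.
- move=> n; apply: measurable_funM => //; exact: measurable_semigroup_process.
- by apply: measurable_funTS; exact: (measurable_fun_process hX).
- by move=> n w _; exact: hK.
- by move=> w _; have /cvg_at_rightP := gen (X t w); apply; split.
Qed.

Lemma generator_step b c : a <= b ->
  (forall t, a <= t < b -> c <= \int[P p]_(w in A) g (X t w)) ->
  c * (b - a) <= \int[P p]_(w in A) f (X b w) - \int[P p]_(w in A) f (X a w).
Proof.
move=> ab cg; have [K hK] := integral_lipschitz.
apply: (@mean_value_right _ (fun t => \int[P p]_(w in A) f (X t w))
  (fun t => \int[P p]_(w in A) g (X t w)) _ _ _ K) => //.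
by move=> t /andP[at_ _]; exact: integral_derive.
Qed.

End generator_estimates.

(** * The exit time *)

Section exit_time.
Context (R : realType) (G : star_graph R) (D : diffusion_data G).
Context (d : measure_display) (Omega : measurableType d).
Context (F : R -> set (set Omega)) (P : star G -> probability Omega R).
Context (X : R -> Omega -> star G).
Hypothesis hX : general_diffusion D F P X.
Context (u : edge G -> R).
Hypothesis hu : forall e, 0 < u e /\ ((u e)%:E < len e)%E.
Local Notation T := (exit_time X (star_nbhd u)).

(** Paths are continuous within [0, +oo[ only; the absolute value extends them to R, where extreme
    values, dense rationals and plain neighbourhoods are at hand. *)
Lemma path_continuous (V : topologicalType) (f : star G -> V) w :
  continuous f -> continuous (fun s : R => f (X `|s| w)).
Proof.
move=> cf s; apply: (@cvg_comp _ _ _ (fun s : R => X `|s| w) f _ (nbhs (X `|s|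
  w))); last exact: cf.
have : {within `[0, +oo[%classic, continuous (X ^~ w)} by exact: (gd_continuous
  hX).
move=> /subspace_continuousP/(_ `|s|);
  rewrite /= in_itv/= normr_ge0 => /(_ isT) H.
apply: (@cvg_comp _ _ _ (fun t : R => `|t|) (X ^~ w) (nbhs s)
  (within `[0, +oo[%classic (nbhs `|s|))); last exact: H.
move=> A wA; have := @norm_continuous R R^o s _ wA.
rewrite nbhs_simpl/=; apply: filterS => t /=; apply.
by rewrite /= in_itv/= normr_ge0.
Qed.

(** This is the event t < T, see [exit_time_gt]. The time interval is closed, so that compactness
    can be used. *)
Definition alive (t : R) : set Omega :=
  [set w | forall s, 0 <= s <= t -> ratio u (X s w) < 1].

Lemma alive_le s t : s <= t -> alive t `<=` alive s.
Proof. by move=> st w wt r /andP[r0 rs]; apply: wt;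
  rewrite r0 (le_trans rs). Qed.

Lemma bigcap_filtration t (A : nat -> set Omega) : 0 <= t ->
  (forall n, F t (A n)) -> F t (\bigcap_n A n).
Proof.
move=> t0 FA; have [sa _ _] := gd_filtration hX; have [F0 FC FU] := sa t t0.
rewrite -[\bigcap_n _]setCK setC_bigcap -setTD; apply: (FC); apply: FU => n.
by rewrite -setTD; exact: FC.
Qed.

Lemma filtration_ratio_le s t c : 0 <= s <= t -> F t [set w | ratio u (X s w)
  <= c].
Proof.
move=> /andP[s0 st]; apply: (filtration_le hX s0 st).
suff mB : measurable ([set q | ratio u q <= c] : set (borel_star G)).
  exact: (gd_adapted hX s0 mB).
have := continuous_measurable_star (@ratio_continuous _ _ u) measurableT
  (@measurable_itv _ `]-oo, c]).
by rewrite setTI; congr (measurable _).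
Qed.

(** A countable dense family of times in [0, t]: absolute values of rationals, capped at [t].
    Integers coding no rational give the time 0. *)
Definition rat_time (t : R) (n : nat) : R := Num.min `|ratr (odflt 0 (unpickle
  n : option rat))| t.

Lemma rat_time_itv t n : 0 <= t -> 0 <= rat_time t n <= t.
Proof. by move=> t0; rewrite /rat_time le_min normr_ge0 t0 ge_min lexx orbT.
  Qed.

(** On the compact [0, t] the maximum of the gauge is attained, so staying below 1 means staying
    below some 1 - 1/(m + 1). This closed condition passes from a dense set of times to all
    times. *)
Lemma aliveE t : 0 <= t -> alive t =
  \bigcup_m \bigcap_n [set w | ratio u (X (rat_time t n) w) <= 1 - m.+1%:R^-1].
Proof.
move=> t0; apply/seteqP; split=> w.
  move=> wt; have [c ct cmax] := @EVT_max R (fun s => ratio u (X `|s| w)) 0 t t0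
    (continuous_subspaceT (@path_continuous _ _ w (@ratio_continuous _ _ u))).
  rewrite in_itv/= in ct; have c1 : 0 < 1 - ratio u (X `|c| w).
    by rewrite subr_gt0 ger0_norm ?wt//; case/andP: ct.
  exists (Num.bound (1 - ratio u (X `|c| w))^-1) => // n _ /=.
  have rt := rat_time_itv n t0.
  have := cmax (rat_time t n); rewrite in_itv/= rt => /(_ isT).
  rewrite (ger0_norm (_ : 0 <= rat_time t n)); last by case/andP: rt.
  move=> h; apply: le_trans h _; rewrite lerBrDl -lerBrDr.
  rewrite invf_ple ?posrE// ltW// (lt_le_trans (archi_boundP _))//.
    by rewrite invr_ge0 ltW.
  by rewrite ler_nat.
move=> [m _ wm] s /andP[s0 st].
(* Folding and capping make every real a time of [0, t]; at a rational the value is that at some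
   [rat_time t n]. *)
pose psi (r : R) := ratio u (X `|Num.min `|r| t| w).
have cpsi : continuous psi.
  move=> r; apply: (@cvg_comp _ _ _ (fun r : R => Num.min `|r| t)
    (fun r : R => ratio u (X `|r| w)) _ (nbhs (Num.min `|r| t))).
    suff : {for r, continuous ((fun r : R => `|r| : R^o) \min (cst t))} by [].
    by apply: continuous_min; [exact: norm_continuous|exact: cvg_cst].
  exact: (@path_continuous _ _ w (@ratio_continuous _ _ u)).
have mt r : `|Num.min `|r| t| = Num.min `|r| t by rewrite ger0_norm// le_min
  normr_ge0.
suff : psi s <= 1 - m.+1%:R^-1.
  rewrite /psi mt ger0_norm// min_l// => /le_lt_trans; apply.
  by rewrite ltrBlDr ltrDl invr_gt0.
apply: contrapT => ns.
have : open (~` [set r | psi r <= 1 - m.+1%:R^-1]).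
  by rewrite openC; apply: (closed_comp _ (@closed_le _ (1 - m.+1%:R^-1))) => r
    _; exact: cpsi.
move=> /(@dense_rat R _ (ex_intro _ s ns))[y [/= nq [q _ qE]]].
apply: nq; have := wm (pickle q) Logic.I; rewrite /= /rat_time pickleK/= qE.
by rewrite /psi mt.
Qed.

Lemma filtration_alive t : 0 <= t -> F t (alive t).
Proof.
move=> t0; rewrite aliveE//; have [sa _ _] := gd_filtration hX.
have [_ _ FU] := sa t t0; apply: FU => m; apply: bigcap_filtration => // n.
by apply: filtration_ratio_le; exact: rat_time_itv.
Qed.

Lemma exit_time_ge0 w : (0 <= T w)%E.
Proof. by apply: le_ereal_inf_tmp => _ [t [t0 _] <-]; rewrite lee_fin. Qed.

(** The strict inequality comes from openness: a path inside at [t] stays inside for a short while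
    longer. *)
Lemma exit_time_gt t w : 0 <= t -> (t%:E < T w)%E <-> alive t w.
Proof.
move=> t0; split=> [tT s /andP[s0 st]|wt].
  rewrite ltNge; apply/negP => rs; move: tT; rewrite ltNge => /negP; apply.
  apply: (@le_trans _ _ s%:E); last by rewrite lee_fin.
  apply: ereal_inf_lbound; exists s => //; split=> // /(star_nbhdE hu).
  by rewrite ltNge rs.
have : \forall s \near t, ratio u (X `|s| w) < 1.
  apply: (cvgr_lt _ (@path_continuous _ _ w (@ratio_continuous _ _ u) t)).
  by rewrite ger0_norm// wt// lexx t0.
move=> [r /= r0 hr].
apply: (@lt_le_trans _ _ (t + r)%:E); first by rewrite lte_fin ltrDl.
apply: le_ereal_inf_tmp => _ [s [s0 nU] <-]; rewrite lee_fin leNgt;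
  apply/negP => str.
apply: nU; apply/(star_nbhdE hu); have [st|ts] := leP s t; first by apply: wt;
  rewrite s0.
have := hr s; rewrite /= (ger0_norm s0); apply.
by rewrite distrC gtr0_norm ?subr_gt0// ltrBlDl.
Qed.

Lemma exit_time_fineK w : (T w < +oo)%E -> (fine (T w))%:E = T w.
Proof. by move=> Tw; rewrite fineK// ge0_fin_numE// exit_time_ge0. Qed.

Lemma exit_time_fine_ge0 w : 0 <= fine (T w).
Proof. by rewrite fine_ge0// exit_time_ge0. Qed.

Lemma ratio_exit_ge1 w : (T w < +oo)%E -> 1 <= ratio u (X (fine (T w)) w).
Proof.
move=> Tw; rewrite leNgt; apply/negP => U.
suff /(exit_time_gt _ (exit_time_fine_ge0 w)) : alive (fine (T w)) w.
  by rewrite exit_time_fineK// ltxx.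
move=> s /andP[s0]; rewrite le_eqVlt => /predU1P[->|sT]; first exact: U.
have /(exit_time_gt w s0) : (s%:E < T w)%E by rewrite -exit_time_fineK//
  lte_fin.
by move=> /(_ s); rewrite s0 lexx => /(_ isT).
Qed.

(** A start inside gives T > 0, and a gauge above 1 at T would be above 1 slightly earlier, when the
    path is still inside. *)
Lemma ratio_exit w : ratio u (X 0 w) < 1 -> (T w < +oo)%E ->
  ratio u (X (fine (T w)) w) = 1.
Proof.
move=> w0 Tw; apply/eqP; rewrite eq_le ratio_exit_ge1// andbT leNgt;
  apply/negP => U.
have T0 : 0 < fine (T w).
  rewrite -lte_fin exit_time_fineK//; apply/(exit_time_gt w (lexx 0)) => s.
  by rewrite -eq_le => /eqP <-.
have : \forall s \near fine (T w), 1 < ratio u (X `|s| w).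
  apply: (cvgr_gt _ (@path_continuous _ _ w (@ratio_continuous _ _ u) (fine (T
    w)))).
  by rewrite gtr0_norm.
move=> [r /= r0 hr].
pose s := Num.max 0 (fine (T w) - r / 2).
have s0 : 0 <= s by rewrite le_max lexx.
have sT : s < fine (T w) by rewrite gt_max T0/=; lra.
have sr : fine (T w) - s < r.
  have : fine (T w) - r / 2 <= s by rewrite le_max lexx orbT.
  by move: (r0 : 0 < r); lra.
have := hr s; rewrite /= (ger0_norm s0) gtr0_norm ?subr_gt0// => /(_ sr).
have /(exit_time_gt w s0) : (s%:E < T w)%E by rewrite -exit_time_fineK//
  lte_fin.
by move=> /(_ s); rewrite s0 lexx => /(_ isT) /ltW; rewrite leNgt => /negbTE ->.
Qed.

(** * Reading the process on a time grid *)

Section stopped.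
Context (f : star G -> R) (delta : R).
Hypotheses (cf : continuous f) (delta0 : 0 < delta).

(* [stopped n] is [f] at the first multiple of [delta] past the exit time, or at
   [n * delta] if that comes first. *)
Fixpoint stopped (n : nat) (w : Omega) : R :=
  if n is k.+1 then
    stopped k w + \1_(alive (k%:R * delta)) w *
      (f (X (k.+1%:R * delta) w) - f (X (k%:R * delta) w))
  else f (X 0 w).

(** Being a value of [f] gives the uniform bound; a delay below [delta] after exit gives the
    convergence to f(X_T). *)
Lemma stoppedP n w : exists r, [/\ 0 <= r, stopped n w = f (X r w) &
  [/\ (T w <= r%:E)%E, (r%:E < T w + delta%:E)%E & r <= n%:R * delta] \/
  r = n%:R * delta /\ forall k, (k < n)%N -> alive (k%:R * delta) w].
Proof.
have d0 := delta0; elim: n => [|n [r [r0 rE]]].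
  by exists 0; split=> //; right; split=> [|k]; rewrite ?mul0r ?ltn0.
have n0 : 0 <= n%:R * delta by rewrite mulr_ge0// ltW.
have nS : n.+1%:R * delta = n%:R * delta + delta by rewrite -natr1 mulrDl mul1r.
case=> [[Tr rT rn]|[rn wn]].
  exists r; split=> //; last by left; split=> //; rewrite nS; lra.
  rewrite /= indicE memNset ?mul0r ?addr0// => /(exit_time_gt w n0).
  by rewrite ltNge (le_trans Tr)// lee_fin.
have [an|an] := pselect (alive (n%:R * delta) w).
  exists (n.+1%:R * delta); split.
  - by rewrite nS; lra.
  - by rewrite /= indicE mem_set// mul1r rE rn addrC subrK.
  - right; split=> // k; rewrite ltnS leq_eqVlt => /predU1P[->//|]; exact: wn.
exists r; split=> //.
  by rewrite /= indicE memNset ?mul0r ?addr0.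
left; split; last by rewrite nS rn; lra.
  rewrite leNgt; apply/negP => /(exit_time_gt w r0); rewrite rn; exact: an.
(* The path was alive at the preceding grid time, which therefore lies before T; for [n = 0] the
   time is 0 < delta. *)
case: n wn rn {n0 nS an rE} => [_ ->|n wn ->].
  by rewrite mul0r (@lt_le_trans _ _ delta%:E) ?lte_fin// leeDr// exit_time_ge0.
rewrite -natr1 mulrDl mul1r EFinD lteD2rE//.
by apply/exit_time_gt; [rewrite mulr_ge0// ltW|exact: wn].
Qed.

Lemma measurable_stopped n : measurable_fun setT (stopped n).
Proof.
elim: n => [|n IH] /=; first exact: (measurable_fun_process hX).
have n0 k : 0 <= k%:R * delta by rewrite mulr_ge0// ltW.
apply: measurable_funD => //; apply: measurable_funM.
  apply: measurable_indic; apply: (filtration_measurable hX) (filtration_alive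
    _); exact: n0.
by apply: measurable_funB; exact: (measurable_fun_process hX).
Qed.

End stopped.

(** (m + 1)^2 steps of length 1/(m + 1) cover [0, m + 1]: the mesh tends to 0 while the horizon
    passes any finite T. *)
Lemma stopped_cvg (f : star G -> R) w : continuous f -> (T w < +oo)%E ->
  stopped f m.+1%:R^-1 (m.+1 * m.+1) w @[m --> \oo] --> f (X (fine (T w)) w).
Proof.
move=> cf Tw; apply/cvgrPdist_le => e e0.
have /cvgrPdist_le/(_ e e0)[r /= r0 hr] := @path_continuous _ _ w cf (fine (T
  w)).
have T0 := exit_time_fine_ge0 w.
suff H m : fine (T w) <= m%:R -> m.+1%:R^-1 < r ->
    `|f (X (fine (T w)) w) - stopped f m.+1%:R^-1 (m.+1 * m.+1) w| <= e.
  near=> m; apply: H; near: m; first exact: nbhs_infty_ger.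
  exact: (near_infty_natSinv_lt (PosNum r0)).
move=> Tm mr.
have m0 : 0 < m.+1%:R^-1 :> R by rewrite invr_gt0.
have [q [q0 -> [[Tq qT _]|[_ al]]]] := stoppedP f m0 (m.+1 * m.+1) w.
  have := hr q; rewrite (ger0_norm q0) (ger0_norm T0); apply => /=.
  move: Tq qT; rewrite -exit_time_fineK// -EFinD lee_fin lte_fin => Tq qT.
  by rewrite distrC ger0_norm ?subr_ge0// ltrBlDl (lt_trans qT)// ltrD2l.
(* The step m (m + 1) is the time m, already past T, so the path cannot be alive there. *)
have := al (m * m.+1)%N; rewrite ltn_mul2r/= leqnn => /(_ isT).
rewrite natrM mulfK ?pnatr_eq0// => /(exit_time_gt _ (ler0n _ _)).
by rewrite -exit_time_fineK// lte_fin ltNge Tm.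
Unshelve. all: by end_near. Qed.

End exit_time.

Lemma Rintegral_full_measure d (T : measurableType d) (R : realType)
    (mu : probability T R) (A : set T) (f : T -> R) : measurable A -> mu A =
      1%E ->
  mu.-integrable setT (EFin \o f) -> \int[mu]_x f x = \int[mu]_(x in A) f x.
Proof.
move=> mA A1 fi; congr fine; have mCA : measurable (~` A) by exact: measurableC.
have CA0 : mu (~` A) = 0%E by rewrite probability_setC// A1 subee.
by rewrite (negligible_integral mCA _ fi CA0)// setTD setCK.
Qed.

(** * The exit law *)

Section exit_law.
Context (R : realType) (G : star_graph R) (D : diffusion_data G).
Context (d : measure_display) (Omega : measurableType d).
Context (F : R -> set (set Omega)) (P : star G -> probability Omega R).
Context (X : R -> Omega -> star G).
Hypothesis hX : general_diffusion D F P X.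
Context (u : edge G -> R).
Hypothesis hu : forall e, 0 < u e /\ ((u e)%:E < len e)%E.
Local Notation T := (exit_time X (star_nbhd u)).
Local Notation alive := (alive X u).
Local Notation stopped := (stopped X u).

Lemma measurable_alive t : 0 <= t -> measurable (alive t).
Proof. by move=> t0; apply: (filtration_measurable hX t0) (filtration_alive hX
  u t0). Qed.

Lemma measurable_exit_lty : measurable [set w | (T w < +oo)%E].
Proof.
rewrite (_ : [set w | _] = ~` \bigcap_n alive n%:R).
  by apply: measurableC; apply: bigcap_measurable => // n _;
    exact: measurable_alive.
apply/seteqP; split=> w /=.
  move=> Tw aw; have := archi_boundP (exit_time_fine_ge0 X u w).
  have /(exit_time_gt hX hu w (ler0n _ _)) := aw (Num.bound (fine (T w)))
    Logic.I.
  by rewrite -(exit_time_fineK Tw) lte_fin => /lt_trans h /h; rewrite ltxx.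
move=> nw; rewrite ltNge; apply/negP => Tw; apply: nw => n _.
by apply/(exit_time_gt hX hu w (ler0n _ _)); rewrite (lt_le_trans _ Tw)// ltry.
Qed.

Lemma measurable_initial p : measurable [set w | X 0 w = p].
Proof.
apply: (filtration_measurable hX (lexx 0)).
suff mp : measurable ([set p] : set (borel_star G)) by exact: (gd_adapted hX
  (lexx 0) mp).
rewrite -[[set p]]setCK; apply: measurableC; apply: sub_sigma_algebra.
rewrite /mkset openC; apply: accessible_closed_set1;
  apply: hausdorff_accessible.
exact: metric_hausdorff.
Qed.

Section expectation.
Context (f g : star G -> R) (C c M : R).
Hypothesis hfg : generator P X f g.
Hypotheses (gC : forall q, `|g q| <= C) (cg : forall q, ratio u q < 1 -> c <= g
  q).
Hypothesis fM : forall q, `|f q| <= M.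

Let cf : continuous f. Proof. by case: hfg => -[]. Qed.
Let cg' : continuous g. Proof. by case: hfg => _ []. Qed.

Lemma expectation_initial p : \int[P p]_w f (X 0 w) = f p.
Proof.
rewrite (Rintegral_full_measure (measurable_initial p)).
- rewrite (@eq_Rintegral _ _ _ _ _ (cst (f p))).
    rewrite Rintegral_cst; last exact: measurable_initial.
    transitivity (f p * fine 1%E); last exact: mulr1.
    by congr (_ * fine _); exact: (gd_initial hX).
  by move=> w; rewrite inE /= => ->.
- exact: (gd_initial hX).
- exact: (integrable_process hX cf fM).
Qed.

Lemma stopped_bound delta n w : 0 < delta -> `|stopped f delta n w| <= M.
Proof. by move=> d0; have [r [_ -> _]] := stoppedP hX hu f d0 n w. Qed.

Lemma integrable_stopped p delta n A : 0 < delta -> measurable A ->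
  (P p).-integrable A (EFin \o stopped f delta n).
Proof.
move=> d0 mA; apply: (@bounded_integrable _ _ _ _ _ _ M) => //.
- by rewrite (le_lt_trans (probability_le1 _ _))// ltry.
- by apply: measurable_funTS; exact: (measurable_stopped hX).
- by move=> w _; exact: stopped_bound.
Qed.

Lemma expectation_stoppedS p delta n : 0 < delta ->
  \int[P p]_w stopped f delta n.+1 w = \int[P p]_w stopped f delta n w +
    (\int[P p]_(w in alive (n%:R * delta)) f (X (n.+1%:R * delta) w) -
     \int[P p]_(w in alive (n%:R * delta)) f (X (n%:R * delta) w)).
Proof.
move=> d0; have n0 k : 0 <= k%:R * delta by rewrite mulr_ge0// ltW.
have mA := measurable_alive (n0 n).
rewrite /= RintegralD//; last 2 first.
- exact: integrable_stopped.
- apply: (@bounded_integrable _ _ _ _ _ _ (2 * M)) => //.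
  + by rewrite (le_lt_trans (probability_le1 _ _))// ltry.
  + apply: measurable_funM; first exact: measurable_indic.
    by apply: measurable_funB; exact: (measurable_fun_process hX).
  + move=> w _; rewrite normrM mulrDl mul1r.
    have ind : `|\1_(alive (n%:R * delta)) w| <= 1 :> R.
      by rewrite indicE normr_nat; case: (_ \in _).
    apply: (le_trans (ler_wpM2r (normr_ge0 _) ind)); rewrite mul1r.
    by rewrite (le_trans (ler_normB _ _))// lerD.
congr (_ + _); rewrite -RintegralB//; try exact: (integrable_process hX cf fM).
rewrite [RHS]Rintegral_mkcond; apply: eq_Rintegral => w _.
by rewrite patchE indicE; case: ifP => _; rewrite ?mul1r ?mul0r.
Qed.

(** For t in [a, b[ split [alive a]: on [alive b] the path is inside at [t] and g >= c, on the rest,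
    which exits by time [b], only g >= - C is available. *)
Lemma alive_increment p a b : 0 <= a -> a <= b ->
  (c * fine (P p (alive b)) - C * (fine (P p (alive a)) - fine (P p (alive
    b)))) * (b - a) <=
  \int[P p]_(w in alive a) f (X b w) - \int[P p]_(w in alive a) f (X a w).
Proof.
move=> a0 ab; apply: (generator_step hX hfg a0 (filtration_alive hX u a0)) =>
  // t /andP[at_ tb].
have t0 := le_trans a0 at_; have b0 := le_trans a0 ab.
have mA := measurable_alive a0; have mB := measurable_alive b0.
have BA : alive b `<=` alive a by exact: alive_le.
have AE : alive a = alive b `|` (alive a `\` alive b) by rewrite setDUK.
have gi A : measurable A -> (P p).-integrable A (EFin \o (fun w => g (X t w))).
  by move=> ?; exact: (integrable_process hX cg' gC).
have mD : measurable (alive a `\` alive b) by exact: measurableD.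
have pfin A : measurable A -> P p A \is a fin_num.
  by move=> ?; rewrite ge0_fin_numE// (le_lt_trans (probability_le1 _ _))//
    ltry.
have PD : fine (P p (alive a `\` alive b)) = fine (P p (alive a)) - fine (P p
  (alive b)).
  rewrite measureD//; last by rewrite (le_lt_trans (probability_le1 _ _))//
    ltry.
  by rewrite setIidr// fineB// pfin.
rewrite AE Rintegral_setU//; last 2 first.
- by rewrite -AE; exact: gi.
- by apply/disj_setPS => w [/= bw [_]].
rewrite -AE -PD; apply: lerD.
- rewrite -Rintegral_cst//; apply: le_Rintegral => //; last 2 first.
  + exact: gi.
  + by move=> w bw; apply: cg; apply: bw; rewrite t0 ltW.
  + by apply: (@bounded_integrable _ _ _ _ _ (cst c) `|c|) => //;
    rewrite ltey_eq pfin.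
- rewrite -mulNr -Rintegral_cst//; apply: le_Rintegral => //; last 2 first.
  + exact: gi.
  + by move=> w _; have := gC (X t w); rewrite ler_norml => /andP[].
  + by apply: (@bounded_integrable _ _ _ _ _ (cst (- C)) `|- C|) => //;
    rewrite ltey_eq pfin.
Qed.

(** The errors of the steps telescope, so their sum does not grow with [n]. As c >= 0, the gain of
    each step is bounded below through the smallest survival probability, that of the last time. *)
Lemma expectation_stopped_ge p delta n : 0 < delta -> 0 <= c ->
  f p + delta * (c * n%:R * fine (P p (alive (n%:R * delta))) - C) <=
  \int[P p]_w stopped f delta n w.
Proof.
move=> d0 c0; pose a k := fine (P p (alive (k%:R * delta))).
have n0 k : 0 <= k%:R * delta by rewrite mulr_ge0// ltW.
have pfin k : P p (alive (k%:R * delta)) \is a fin_num.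
  by rewrite ge0_fin_numE// (le_lt_trans (probability_le1 _ (measurable_alive
    _)))// ltry.
have C0 : 0 <= C := le_trans (normr_ge0 _) (gC (vertex G)).
have kS k : k.+1%:R * delta = k%:R * delta + delta by rewrite -natr1 mulrDl
  mul1r.
have aS k : a k.+1 <= a k.
  apply: fine_le => //; apply: le_measure; rewrite ?inE;
    try exact: measurable_alive.
  by apply: alive_le; rewrite kS lerDl ltW.
have a01 : a 0%N <= 1.
  by rewrite -lee_fin fineK// probability_le1//; exact: measurable_alive.
have a0 k : 0 <= a k by exact: fine_ge0.
rewrite -/(a n).
(* The telescoped form, the one stable under induction. *)
suff : f p + delta * (c * n%:R * a n - C * (a 0%N - a n)) <= \int[P p]_w
  stopped f delta n w.
  apply: le_trans; rewrite lerD2l ler_pM2l// lerD2l lerN2 ler_piMr//.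
  by have := a0 n; lra.
elim: n => [|n IH]; first by rewrite expectation_initial mulr0 mul0r !subrr
  mulr0 subrr mulr0 addr0.
rewrite expectation_stoppedS//;
  have := alive_increment p (n0 n) (_ : n%:R * delta <= n.+1%:R * delta).
rewrite -/(a n) -/(a n.+1) kS lerDl (ltW d0) => /(_ isT) H.
apply: le_trans (lerD IH H).
have h : 0 <= c * n%:R * a n - c * n%:R * a n.+1.
  by rewrite subr_ge0 ler_wpM2l// mulr_ge0.
rewrite -subr_ge0; apply: le_trans (mulr_ge0 (ltW d0) h) _.
by rewrite le_eqVlt; apply/orP; left; apply/eqP; rewrite -natr1; ring.
Qed.

End expectation.

(** On a grid of mesh 1, paths that never exit contribute at least c at each step while [f] stays
    bounded: n c P(T = +oo) <= 2M + C for every [n]. *)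
Lemma exit_time_finite (f g : star G -> R) c p : generator P X f g -> 0 < c ->
  (forall q, ratio u q < 1 -> c <= g q) -> P p [set w | (T w < +oo)%E] = 1%E.
Proof.
move=> hfg c0 cg; have [[_ [M fM]] [_ [C gC]] _ _] := hfg.
have mT := measurable_exit_lty.
suff : P p (~` [set w | (T w < +oo)%E]) = 0%E.
  by rewrite -{2}[[set w | _]]setCK => N0;
    rewrite probability_setC ?N0 ?sube0//; exact: measurableC.
have pfin A : measurable A -> P p A \is a fin_num.
  by move=> mA; rewrite ge0_fin_numE// (le_lt_trans (probability_le1 _ mA))//
    ltry.
set N := ~` _; have mN : measurable N by exact: measurableC.
have M0 : 0 <= M := le_trans (normr_ge0 _) (fM (vertex G)).
have C0 : 0 <= C := le_trans (normr_ge0 _) (gC (vertex G)).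
suff : fine (P p N) <= 0.
  move=> N0; apply/eqP; rewrite -(fineK (pfin _ mN)) eqe eq_le N0 fine_ge0//.
have bnd n : n%:R * (c * fine (P p N)) <= 2 * M + C.
  have := @expectation_stopped_ge f g C c M hfg gC cg fM p 1 n ltr01 (ltW c0).
  have : \int[P p]_w stopped f 1 n w <= M.
    apply: le_trans (ler_norm _) _.
    apply: (@le_trans _ _ (M * fine (P p setT))).
      apply: norm_Rintegral_le => //.
      - by rewrite (le_lt_trans (probability_le1 _ _))// ltry.
      - by apply: (measurable_stopped hX) => //; case: hfg => -[].
      - by move=> w _; apply: stopped_bound.
    rewrite ler_piMr// -lee_fin fineK ?probability_le1//; exact: pfin.
  have : fine (P p N) <= fine (P p (alive (n%:R * 1))).
    have n0 : 0 <= n%:R * 1 :> R by rewrite mulr1.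
    apply: fine_le; [exact: pfin|by apply: pfin; exact: measurable_alive|].
    apply: le_measure; rewrite ?inE//; first exact: measurable_alive.
    move=> w /= /negP; rewrite -leNgt => Tw; apply/(exit_time_gt hX hu w n0).
    by rewrite (lt_le_trans _ Tw)// ltry.
  rewrite mul1r => NA stM; have := fM p; rewrite ler_norml => /andP[fp _].
  have : c * n%:R * fine (P p N) <= c * n%:R * fine (P p (alive (n%:R * 1))).
    by rewrite ler_wpM2l// mulr_ge0// ltW.
  by rewrite mulrCA mulrA; lra.
rewrite leNgt; apply/negP => N0.
have cN : 0 < c * fine (P p N) by rewrite mulr_gt0.
have := archi_boundP (_ : 0 <= (2 * M + C) / (c * fine (P p N))).
rewrite divr_ge0 ?(ltW cN)// ?addr_ge0 ?mulr_ge0// => /(_ isT).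
by rewrite ltr_pdivrMr// ltNge bnd.
Qed.

(** Pointwise limit of the grid values, each built from finitely many deterministic times and events
    [alive]. *)
Lemma measurable_exit_position (f : star G -> R) : continuous f ->
  measurable_fun [set w | (T w < +oo)%E] (fun w => f (X (fine (T w)) w)).
Proof.
move=> cf; apply: (@measurable_fun_cvg _ _ _ _
  (fun m => stopped f m.+1%:R^-1 (m.+1 * m.+1))).
  by move=> m; apply: measurable_funTS; exact: (measurable_stopped hX).
by move=> w Tw; exact: (stopped_cvg hX hu).
Qed.

Lemma generator_opp (f g : star G -> R) :
  generator P X f g -> generator P X (\- f) (\- g).
Proof.
case=> -[cf [M fM]] [cg [C gC]] gen [K genK].
have sN t p : 0 < t -> (semigroup P X t (\- f) p - (\- f) p) / t =
    - ((semigroup P X t f p - f p) / t).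
  move=> t0; have -> : semigroup P X t (\- f) p = - semigroup P X t f p.
    rewrite /semigroup -mulN1r -RintegralZl//;
      last exact: (integrable_process hX cf fM p (ltW t0)).
    by apply: eq_Rintegral => w _; rewrite mulN1r.
  by rewrite -mulNr opprB opprK addrC.
split.
- split; first by move=> p; apply: continuousN; exact: cf.
  by exists M => p; rewrite normrN.
- split; first by move=> p; apply: continuousN; exact: cg.
  by exists C => p; rewrite normrN.
- move=> p; apply: cvg_trans (cvgN (gen p)); apply: near_eq_cvg; near=> t.
  by rewrite /= sN.
- exists K; near=> t => p; rewrite sN// normrN; move: p; near: t; exact: genK.
Unshelve. all: by end_near. Qed.

Lemma stopped_opp (f : star G -> R) delta n w :
  stopped (\- f) delta n w = - stopped f delta n w.
Proof. by elim: n => [//|n IH] /=;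
  rewrite IH opprD -mulrN opprB opprK addrC [in RHS]addrC; congr (_ * _ + _);
  rewrite addrC. Qed.

(** The expectation of the grid value differs from f(p) by at most C / (m + 1), and the grid values
    converge boundedly on [A]. The event [A] is left free so that further almost sure properties can
    be put into it. *)
Lemma expectation_exit (f g : star G -> R) p (A : set Omega) : generator P X f
  g ->
  (forall q, ratio u q < 1 -> g q = 0) ->
  measurable A -> P p A = 1%E -> A `<=` [set w | (T w < +oo)%E] ->
  \int[P p]_(w in A) f (X (fine (T w)) w) = f p.
Proof.
move=> hfg g0 mA A1 AT; have [[cf [M fM]] [cg [C gC]] _ _] := hfg.
have C0 : 0 <= C := le_trans (normr_ge0 _) (gC (vertex G)).
have lim1 : \int[P p]_(w in A) stopped f m.+1%:R^-1 (m.+1 * m.+1) w @[m -->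
  \oo] -->
    \int[P p]_(w in A) f (X (fine (T w)) w).
  apply: (@bounded_cvg_Rintegral _ _ _ _ _ _ _ M) => //.
  - by rewrite (le_lt_trans (probability_le1 _ _))// ltry.
  - by move=> m; apply: measurable_funTS; exact: (measurable_stopped hX).
  - apply: measurable_funS AT (measurable_exit_position cf).
    exact: measurable_exit_lty.
  - by move=> m w _; apply: stopped_bound => //; rewrite invr_gt0.
  - by move=> w /AT Tw; exact: (stopped_cvg hX hu).
apply: (cvg_unique (@Rhausdorff R) lim1).
have gN := generator_opp hfg.
have g0' q : ratio u q < 1 -> 0 <= g q by move=> /g0 ->.
have gN0 q : ratio u q < 1 -> 0 <= (\- g) q by move=> /g0 /= ->; rewrite oppr0.
have gNC q : `|(\- g) q| <= C by rewrite normrN.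
have fNM q : `|(\- f) q| <= M by rewrite normrN.
have C1 : 0 < C + 1 by rewrite ltr_wpDl.
apply/cvgrPdist_le => e e0; suff H m : m.+1%:R^-1 < e / (C + 1) ->
    `|f p - \int[P p]_(w in A) stopped f m.+1%:R^-1 (m.+1 * m.+1) w| <= e.
  have eC : 0 < e / (C + 1) by rewrite divr_gt0.
  by near=> m; apply: H; near: m; exact: (near_infty_natSinv_lt (PosNum eC)).
have m0 : 0 < m.+1%:R^-1 :> R by rewrite invr_gt0.
have si : (P p).-integrable setT (EFin \o stopped f m.+1%:R^-1 (m.+1 * m.+1)).
  exact: (integrable_stopped hfg fM).
rewrite -(Rintegral_full_measure mA A1)// => meC.
have := expectation_stopped_ge hfg gC g0' fM p (m.+1 * m.+1) m0 (lexx 0).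
have := expectation_stopped_ge gN gNC gN0 fNM p (m.+1 * m.+1) m0 (lexx 0).
have -> : \int[P p]_w stopped (\- f) m.+1%:R^-1 (m.+1 * m.+1) w =
    - \int[P p]_w stopped f m.+1%:R^-1 (m.+1 * m.+1) w.
  rewrite -mulN1r -RintegralZl//.
  by apply: eq_Rintegral => w _; rewrite stopped_opp mulN1r.
set I := \int[P p]_w stopped f _ _ w; rewrite !mul0r !sub0r => H1 H2.
have {}H1 : - f p - m.+1%:R^-1 * C <= - I by rewrite -mulrN; exact: H1.
have {}H2 : f p - m.+1%:R^-1 * C <= I by rewrite -mulrN; exact: H2.
have Ce : m.+1%:R^-1 * C <= e.
  move: meC; rewrite ltr_pdivlMr// => /ltW; apply: le_trans.
  by rewrite ler_pM2l// lerDl.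
rewrite ler_distl; apply/andP; split.
  by move: H1; rewrite -opprD lerN2 lerBlDr => /le_trans; apply; rewrite lerD2l.
by move: H2; rewrite lerBlDr => /le_trans; apply; rewrite lerD2l.
Unshelve. all: by end_near. Qed.

End exit_law.

(** * The exit event and its probability *)

Lemma measure_setI_full d (T : measurableType d) (R : realType)
    (mu : probability T R) (A B : set T) : measurable A -> measurable B ->
  mu A = 1%E -> mu (B `&` A) = mu B.
Proof.
move=> mA mB A1; have CA0 : mu (~` A) = 0%E by rewrite probability_setC// A1
  subee.
have N : mu (B `\` A) = 0%E.
  by apply: (subset_measure0 (measurableD mB mA) (measurableC mA) _ CA0) => w
    [].
transitivity (mu (B `\` A) + mu (B `&` A))%E; last exact/esym/measureDI.
by rewrite N add0e.
Qed.

Section exit_event.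
Context (R : realType) (G : star_graph R) (D : diffusion_data G).
Context (d : measure_display) (Omega : measurableType d).
Context (F : R -> set (set Omega)) (P : star G -> probability Omega R).
Context (X : R -> Omega -> star G).
Hypothesis hX : general_diffusion D F P X.
Context (u : edge G -> R).
Hypothesis hu : forall e, 0 < u e /\ ((u e)%:E < len e)%E.
Local Notation T := (exit_time X (star_nbhd u)).

Definition exit_event (j : edge G) : set Omega :=
  [set w | (T w < +oo)%E /\ label (X (fine (T w)) w) = j].

(** [label] is arbitrary at the vertex, so the event is described by the continuous [ray j] being
    positive at X_T; the gauge being at least 1 there, X_T is not the vertex. *)
Lemma measurable_exit_event j : measurable (exit_event j).
Proof.
have := measurable_exit_position hX hu (@ray_continuous _ _ j)
  (measurable_exit_lty hX hu) (@measurable_itv _ `]0, +oo[).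
congr (measurable _); apply/seteqP; split=> w /=; rewrite in_itv/= andbT /ray.
  by case=> Tw; case: eqVneq => // _; rewrite ltxx.
case=> Tw lj; split=> //; rewrite lj eqxx lt0r coord_ge0 andbT.
apply/eqP => c0; have := ratio_exit_ge1 hX hu Tw.
by rewrite /ratio /star_fun c0 mul0r ler10.
Qed.

(** Almost surely X_T is one of the points (i, u_i), where [f] takes the values of the indicator of
    the exit event. *)
Lemma exit_prob_eq (f g : star G -> R) (j : edge G) p : generator P X f g ->
  (forall q, ratio u q < 1 -> g q = 0) ->
  (forall e, f (pt e (u e)) = (e == j)%:R) ->
  P p [set w | (T w < +oo)%E] = 1%E -> ratio u p < 1 ->
  exit_prob P X (star_nbhd u) j p = (f p)%:E.
Proof.
move=> hfg g0 fj T1 pU; have u0 e : 0 < u e by case: (hu e).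
(* Starting at [p], inside the neighbourhood, is what makes the gauge equal to 1 at T. *)
pose A := [set w | (T w < +oo)%E] `&` [set w | X 0 w = p].
have mT := measurable_exit_lty hX hu; have m0 := measurable_initial hX p.
have mA : measurable A by exact: measurableI.
have A1 : P p A = 1%E.
  rewrite -T1; apply: measure_setI_full => //; exact: (gd_initial hX).
rewrite -(expectation_exit hX hu hfg g0 mA A1); last by move=> w [].
rewrite (@eq_Rintegral _ _ _ _ _ (\1_(exit_event j))) => [|w].
  rewrite /Rintegral integral_indic//; last exact: measurable_exit_event.
  transitivity (fine (P p (exit_event j)))%:E; last first.
    by congr (fine _)%:E; apply/esym/measure_setI_full => //;
      exact: measurable_exit_event.
  rewrite fineK// ge0_fin_numE// (le_lt_trans (probability_le1 _ _)) ?ltry//.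
  exact: measurable_exit_event.
rewrite inE => -[Tw w0]; have := ratio_exit hX hu (_ : ratio u (X 0 w) < 1) Tw.
rewrite w0 => /(_ pU); set q := X (fine (T w)) w.
rewrite /ratio /star_fun => /(congr1 ( *%R^~ (u (label q)))).
rewrite divfK ?gt_eqF// mul1r => qu.
rewrite -[q]ptK qu fj indicE /exit_event; congr ((nat_of_bool _)%:R).
by apply/eqP/idP => [qj|]; [rewrite inE|rewrite inE; case].
Qed.

End exit_event.

Theorem proposition3p3 (R : realType) (G : star_graph R)
    (D : diffusion_data G)
    (d : measure_display) (Omega : measurableType d)
    (F : R -> set (set Omega)) (P : star G -> probability Omega R)
    (X : R -> Omega -> star G)
    (hX : general_diffusion D F P X)
    (u : edge G -> R)
    (hu : forall e, 0 < u e /\ ((u e)%:E < len e)%E)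
    (hsum : \sum_(i : edge G)
              bias D i * rderiv (scale D i) 0 / scale D i (u i) != 0) :
  forall (j e : edge G) (x : R), 0 <= x < u e ->
    exit_prob P X (star_nbhd u) j (pt e x) =
    ((scale D e (u e) - scale D e x) / scale D e (u e)
       * (\sum_(i : edge G)
            bias D i * rderiv (scale D i) 0 / scale D i (u i))^-1
       * (bias D j * rderiv (scale D j) 0 / scale D j (u j))
     + (j == e)%:R * (scale D e x / scale D e (u e)))%:E.
Proof.
move=> j e x /andP[x0 xu].
have u0 i : 0 < u i by case: (hu i).
have Eu i : on_edge i (u i) by split; [exact: ltW|case: (hu i)].
have Ex : on_edge e x by apply: on_edge_le (ltW xu) (Eu e).
have su0 i : 0 < scale D i (u i) by exact: scale_gt0.
pose ds i := rderiv (scale D i) 0.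
pose W i := bias D i * ds i / scale D i (u i).
set S := \sum_(i : edge G) _ in hsum *.
have pU : ratio u (pt e x) < 1.
  rewrite /ratio (@star_fun_pt _ _ _ 0)//; last by move=> i; rewrite mul0r.
  by rewrite ltr_pdivrMr// mul1r.
have ds_ge0 i : 0 <= ds i.
  apply: limr_ge; first exact: scale_rderivable0.
  near=> h; rewrite /rquotient add0r scale0 subr0.
  have h0 : 0 < h by [].
  rewrite divr_ge0 ?(ltW h0)//; apply/ltW/scale_gt0 => //.
  apply: on_edge_le (ltW h0) _ (Eu i).
  by near: h; exact: nbhs_right_le.
(* All terms are non-negative, so if this sum vanished, so would each term, and with them the sum
   inverted in the formula. *)
have dS0 : \sum_(i : edge G) bias D i * ds i != 0.
  apply: contra hsum => /eqP dS; rewrite /S big1// => i _.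
  have : bias D i * ds i = 0.
    apply/eqP; move: dS => /eqP; rewrite psumr_eq0.
      by move=> /allP/(_ i); rewrite mem_index_enum => /(_ isT).
    by move=> k _; rewrite mulr_ge0// ltW// bias_gt0.
  by rewrite -/(ds i) => ->; rewrite mul0r.
have T1 : P (pt e x) [set w | (exit_time X (star_nbhd u) w < +oo)%E] = 1%E.
  (* The common slope meeting the vertex condition for Lf = 1, that is for [k = 2]. *)
  pose c := stickiness D / \sum_(i : edge G) bias D i * ds i.
  have [|f [g [/(gd_generator hX) hfg g1 _]]] :=
    @star_solution_exists _ _ D u hu 0 (fun=> c) 2.
    rewrite (eq_bigr (fun i => c * (bias D i * ds i))) => [|i _];
      last by rewrite mulrCA.
    by rewrite -mulr_sumr /c divfK// divff ?mulr1.
  apply: (exit_time_finite hX hu _ hfg ltr01) => q /ltW/g1 ->.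
  by rewrite divff.
(* The value at the vertex: the slopes below lead from [a] to 1_(i = j) at u_i, and the vertex
   condition becomes W_j - a S = 0. *)
pose a := S^-1 * W j.
have [|f [g [/(gd_generator hX) hfg g0 fE]]] := @star_solution_exists _ _ D u
  hu a
  (fun i => ((i == j)%:R - a) / scale D i (u i)) 0.
  rewrite mul0r mulr0.
  rewrite (eq_bigr (fun i => (i == j)%:R * W i - a * W i)) => [|i _];
    last first.
    by rewrite -mulrBl /W -/(ds i); ring.
  rewrite sumrB -mulr_sumr (bigD1 j)//= eqxx mul1r big1 => [|i /negbTE ->];
    last by rewrite mul0r.
  by rewrite addr0 /a -/S; rewrite mulrAC mulVf// mul1r subrr.
rewrite (exit_prob_eq hX hu hfg (j := j))//.
- rewrite fE//; last by rewrite x0 ltW.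
  congr (_%:E); rewrite -/(ds j) -/(W j) /a eq_sym.
  by field; rewrite hsum gt_eqF.
- by move=> q /ltW/g0 ->; rewrite mul0r.
- move=> i; rewrite fE//; last by rewrite lexx ltW.
  by rewrite divfK ?(gt_eqF (su0 i))// addrC subrK.
Unshelve. all: by end_near. Qed.
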